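(* Let $n\ge 1$. For any states $x,y\in\mathbb{Z}_2^n$ and any time $t\geq 0$, $$\hat{v}(x,y,t) = \inf_{c\in\mathcal{C}} \mathbb{P}\left[\tau^c >t \,|\, X_0=x,\ Y_0=y\right].$$ In other words, the coupling time $\hat{\tau}$ of the strategy $\hat{c}$ is the stochastic minimum of all co-adapted coupling times for the pair $(X,Y)$.
   Context: **State space.** $\mathbb{Z}_2^n$ is the group of binary $n$-tuples under coordinate-wise addition modulo 2. For $x\in\mathbb{Z}_2^n$ write $x=(x(1),\dots,x(n))$. For $1\le i\le n$, $e_i$ is the element with a 1 in coordinate $i$ and 0 elsewhere. $|x-y|=\sum_{i=1}^n|x(i)-y(i)|$ is the Hamming distance. **Random walk.** The continuous-time simple symmetric random walk on $\mathbb{Z}_2^n$ is driven by a marked Poisson process of rate $n$ with marks uniform on $\{1,\dots,n\}$: coordinate $i$ is flipped at the incident times whose mark is $i$. Equivalently, the $n$ coordinates flip independently, each at rate 1. $X$ and $Y$ denote two such random walks, started from $x$ and $y$ respectively. **Couplings.** A coupling of $X$ and $Y$ is a process $(X^c,Y^c)$ on $\mathbb{Z}_2^n\times\mathbb{Z}_2^n$ such that $X^c$ has the same distribution (as a process) as $X$, and $Y^c$ has the same distribution as $Y$. Here $c$ denotes the coupling strategy. The coupling $(X^c,Y^c)$ is called co-adapted if there exists a filtration $(\mathcal{F}_t)_{t\ge0}$ such that 1. $X^c$ and $Y^c$ are both adapted to $(\mathcal{F}_t)_{t\ge 0}$; 2. for any $0\le s\le t$, $\mathcal{L}(X^c_t\,|\,\mathcal{F}_s)=\mathcal{L}(X^c_t\,|\,X^c_s)$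 and $\mathcal{L}(Y^c_t\,|\,\mathcal{F}_s)=\mathcal{L}(Y^c_t\,|\,Y^c_s)$, where $\mathcal{L}$ denotes (conditional) law. $\mathcal{C}$ is the class of all co-adapted couplings. The joint process is not required to be Markov. **Coupling time.** $\tau^c=\inf\{t\ge 0 : X^c_s=Y^c_s \text{ for all } s\ge t\}$. **The strategy $\hat{c}$.** Under $\hat c$ the pair $(X,Y)$ is a continuous-time Markov chain on $\mathbb{Z}_2^n\times\mathbb{Z}_2^n$. In state $(x,y)$, let $U=\{i: x(i)\ne y(i)\}$, $M=\{i: x(i)=y(i)\}$ and $N=|U|$. The transitions are: - for each $i\in M$, $(x,y)\to(x+e_i,y+e_i)$ at rate 1; - if $N$ is odd: for each $i\in U$, $(x,y)\to(x+e_i,y)$ at rate 1 and $(x,y)\to(x,y+e_i)$ at rate 1; - if $N$ is even and $N\ge2$: for each ordered pair of distinct $i,j\in U$, $(x,y)\to(x+e_i,y+e_j)$ at rate $1/(N-1)$. Write $\hat\tau=\tau^{\hat c}$ and $\hat v(x,y,t)=\mathbb{P}[\hat\tau>t\,|\,X_0=x,\,Y_0=y]$. *)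

(* Defs.v *)
From HB Require Import structures.
From mathcomp Require Import all_boot all_order all_algebra.
From mathcomp Require Import all_classical all_reals all_analysis.
Set Implicit Arguments.
Unset Strict Implicit.
Unset Printing Implicit Defensive.
Import Order.TTheory GRing.Theory Num.Theory.
Import numFieldNormedType.Exports.
Local Open Scope classical_set_scope.
Local Open Scope ring_scope.

(* Processes are functions Z : R -> Omega -> S, of which only the values at
   times t >= 0 matter; the state space S is finite, so that every subset of
   S is measurable and a law on S is determined by its masses at points. *)

Section MarkovChain.
Context {R : realType} {S : finType}.

(* The Q-matrix of the off-diagonal rates q; the values q s s are ignored. *)
Definition generator (q : S -> S -> R) (s s' : S) : R :=
  if s == s' then - \sum_(u : S | u != s) q s u else q s s'.

Fixpoint kernel_pow (A : S -> S -> R) (k : nat) (s s' : S) : R :=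
  if k is k'.+1 then \sum_(u : S) A s u * kernel_pow A k' u s'
  else (s == s')%:R.

(* The transition function exp(tQ) *)
Definition transition (q : S -> S -> R) (t : R) (s s' : S) : R :=
  limn (series (fun k : nat =>
    t ^+ k / k`!%:R * kernel_pow (generator q) k s s')).

(* For l = [:: (t_1, s_1); ...; (t_k, s_k)], the product of the
   p_{t_i - t_{i-1}}(s_{i-1}, s_i), where (t_0, s_0) = (t, s). *)
Fixpoint path_prob (q : S -> S -> R) (t : R) (s : S) (l : seq (R * S)) : R :=
  if l is (t', s') :: l' then
    transition q (t' - t) s s' * path_prob q t' s' l'
  else 1.

(* Càdlàg paths on [0, +oo[ for the discrete topology of S *)
Definition cadlag (f : R -> S) : Prop :=
  forall t : R, 0 <= t ->
    (\forall u \near t^'+, f u = f t) /\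
    (0 < t -> exists s : S, \forall u \near t^'-, f u = s).

Context {d : measure_display} {Omega : measurableType d}.

(* Z is a continuous-time Markov chain with jump rates q started from s0.
   Together with the regularity of the paths, the finite-dimensional
   distributions determine the law of Z as a process; the time 0 is allowed
   in l, so that they include Z_0 = s0 almost surely. *)
Definition is_ctmc (P : probability Omega R) (q : S -> S -> R) (s0 : S)
    (Z : R -> Omega -> S) : Prop :=
  [/\ forall (t : R) (s : S), 0 <= t -> measurable (Z t @^-1` [set s]),
      forall w : Omega, cadlag (Z ^~ w)
    & forall l : seq (R * S), path <=%R 0 (unzip1 l) ->
      P [set w | all (fun ts => Z ts.1 w == ts.2) l]
      = (path_prob q 0 s0 l)%:E].

Definition filtration (F : R -> set (set Omega)) : Prop :=
  [/\ forall t : R, 0 <= t -> sigma_algebra [set: Omega] (F t),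
      forall t : R, 0 <= t -> F t `<=` measurable
    & forall s t : R, 0 <= s -> s <= t -> F s `<=` F t].

Definition adapted (F : R -> set (set Omega)) (Z : R -> Omega -> S) : Prop :=
  forall (t : R) (s : S), 0 <= t -> F t (Z t @^-1` [set s]).

(* g is a version of the conditional probability P(A | G), for a
   sub-sigma-algebra G. *)
Definition is_cond_prob (P : probability Omega R) (G : set (set Omega))
    (A : set Omega) (g : Omega -> R) : Prop :=
  [/\ forall B : set R, measurable B -> G (g @^-1` B),
      P.-integrable [set: Omega] (EFin \o g)
    & forall B : set Omega, G B ->
      (\int[P]_(w in B) (g w)%:E = P (A `&` B))%E].

(* L(Z_t | F_s) = L(Z_t | Z_s) for 0 <= s <= t: as sigma(Z_s) is included in
   F_s when Z is adapted, almost sure equality of the two conditional laws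
   amounts to having a common version. *)
Definition markov_wrt (P : probability Omega R) (F : R -> set (set Omega))
    (Z : R -> Omega -> S) : Prop :=
  forall (s t : R) (z : S), 0 <= s -> s <= t ->
    exists g : Omega -> R,
      is_cond_prob P (F s) (Z t @^-1` [set z]) g /\
      is_cond_prob P (preimage_set_system [set: Omega] (Z s) [set: set S])
        (Z t @^-1` [set z]) g.

(* The coupling time of two processes, +oo if they do not couple *)
Definition coupling_time (X Y : R -> Omega -> S) (w : Omega) : \bar R :=
  ereal_inf [set t%:E | t in
    [set t : R | 0 <= t /\ forall s : R, t <= s -> X s w = Y s w]].

Definition coupling_tail (P : probability Omega R) (X Y : R -> Omega -> S)
    (t : R) : \bar R :=
  P [set w | (t%:E < coupling_time X Y w)%E].

End MarkovChain.

Notation hypercube n := {ffun 'I_n -> 'Z_2}.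

Section Hypercube.
Context {R : realType} {n : nat}.
Implicit Types x y : hypercube n.

Definition unit_vec (i : 'I_n) : hypercube n := [ffun j => (j == i)%:R].

Definition unmatched x y : {set 'I_n} := [set i | x i != y i].

(* Independent rate 1 flips of the coordinates (equivalently, a Poisson process
   of rate n with marks uniform on the coordinates): each x -> x + e_i has
   rate 1, and no two coordinates flip at the same time. *)
Definition walk_rate x x' : R :=
  \sum_(i : 'I_n) (x' == x + unit_vec i)%:R.

Definition hat_rate (z z' : hypercube n * hypercube n) : R :=
  let: (x, y) := z in
  let U := unmatched x y in
  let N := #|U| in
  \sum_(i in ~: U) (z' == (x + unit_vec i, y + unit_vec i))%:R
  + (if odd N then
       \sum_(i in U) ((z' == (x + unit_vec i, y))%:R
                      + (z' == (x, y + unit_vec i))%:R)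
     else
       \sum_(i in U) \sum_(j in U | j != i)
         (N.-1)%:R^-1 * (z' == (x + unit_vec i, y + unit_vec j))%:R).

Context {d : measure_display} {Omega : measurableType d}.

Definition is_coupling (P : probability Omega R) x y
    (X Y : R -> Omega -> hypercube n) : Prop :=
  is_ctmc P walk_rate x X /\ is_ctmc P walk_rate y Y.

Definition coadapted (P : probability Omega R)
    (X Y : R -> Omega -> hypercube n) : Prop :=
  exists F : R -> set (set Omega),
    [/\ filtration F, adapted F X, adapted F Y,
        markov_wrt P F X & markov_wrt P F Y].

Definition is_hat_strategy (P : probability Omega R) x y
    (X Y : R -> Omega -> hypercube n) : Prop :=
  is_ctmc P hat_rate (x, y) (fun t w => (X t w, Y t w)).

End Hypercube.

(* The values of P(tau^c > t), for c ranging over the co-adapted couplings of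
   the walks started from x and y, on arbitrary probability spaces *)
Definition coadapted_tails (R : realType) (n : nat) (x y : hypercube n)
    (t : R) : set (\bar R) :=
  [set p | exists (d : measure_display) (Omega : measurableType d)
             (P : probability Omega R) (X Y : R -> Omega -> hypercube n),
     [/\ is_coupling P x y X Y, coadapted P X Y & p = coupling_tail P X Y t]].

(* Main.v *)
Require Import Defs.
From mathcomp Require Import all_boot all_order all_algebra.
From mathcomp Require Import all_classical all_reals all_analysis.
From mathcomp Require Import measurable_realfun.
From mathcomp Require Import ring lra zify.
Set Implicit Arguments.
Unset Strict Implicit.
Unset Printing Implicit Defensive.
Import Order.TTheory GRing.Theory Num.Theory.
Import numFieldNormedType.Exports.
Local Open Scope classical_set_scope.
Local Open Scope ring_scope.

(** Under the strategy, the number N of unmatched coordinates is a pure death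
    chain: N goes to N - 1 at rate 2 N if N is odd and to N - 2 at rate N if N
    is even. Let w(N, t) be the probability that this chain is not yet at 0 at
    time t ([surv]). It is an explicit polynomial in 1 - exp (- 2 t), and it
    satisfies w' = - 2 N D, where D is the loss of w per flipped unmatched
    coordinate: D = w(N) - w(N - 1) for odd N, D = (w(N) - w(N - 2)) / 2 for
    even N. Comparison of differential inequalities shows that w increases
    with N, and that from any N a move which flips k <= 2 unmatched
    coordinates lowers w by at most k D ([surv_flips]): pairs of flips are the
    best moves from even states, single flips from odd ones. Each of the two
    walks flips the unmatched coordinates at total rate N, so no coupling can
    make w decrease faster than at the rate 2 N D, which the strategy attains.

    A co-adapted coupling has no joint generator, and the argument is therefore
    made over a time step h. Given the past F_s, the pair (X_{s+h}, Y_{s+h}) is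
    a coupling of the two one-step laws of the walk ([coadapted_markov]); the
    inequality of [surv_flips] produces a dual certificate for the
    corresponding transport problem, namely a sum of one function of X_{s+h}
    and one function of Y_{s+h} lying below w ([potential_add_le]), and the
    mean of the certificate is known from the one-step laws. Hence
    s |-> E w(N_s, t - s) decreases by at most O(h^2) over each step
    ([coadapted_step]). Summing over the steps and letting h tend to 0 gives
    P(X_t <> Y_t) >= w(N_0, t), and the reverse inequality for the strategy
    ([hat_apart_le]).

    Paths being right-continuous, tau > t as soon as X_t <> Y_t; for the
    strategy the two events agree almost surely, because its rates never
    separate matched walks. Finally the strategy competes in the infimum: its
    marginals are walks because the generator of the pair, applied to functions
    of one component, is that of the walk, and it is co-adapted in the natural
    filtration of the pair. *)

(** * Transition functions of finite chains *)

Section TransitionFunction.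
Context {R : realType} {S : finType}.
Implicit Types (q : S -> S -> R) (f : S -> R) (t h M : R).

(** The generator as an operator on functions: the rows of a Q-matrix sum to
    zero, so that it only sees the increments of [f]. *)
Definition gen q f (s : S) : R := \sum_(u : S) q s u * (f u - f s).

Lemma generator_sum q f s : \sum_(u : S) generator q s u * f u = gen q f s.
Proof.
rewrite /gen (bigD1 s)//= [RHS](bigD1 s)//= subrr mulr0 add0r.
rewrite /generator eqxx mulNr mulr_suml -sumrN -big_split/=.
by apply: eq_bigr => u us; rewrite eq_sym (negPf us); ring.
Qed.

Lemma kernel_pow_sum q k f s :
  \sum_(u : S) kernel_pow (generator q) k s u * f u = iter k (gen q) f s.
Proof.
elim: k s => [|k IH] s /=.
  rewrite (bigD1 s)//= eqxx mul1r big1 ?addr0// => u us.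
  by rewrite eq_sym (negPf us) mul0r.
rewrite -generator_sum; under eq_bigr do rewrite mulr_suml.
rewrite exchange_big; apply: eq_bigr => u _ /=.
by rewrite -IH mulr_sumr; apply: eq_bigr => v _; rewrite mulrA.
Qed.

Lemma kernel_powE q k s s' :
  kernel_pow (generator q) k s s' = iter k (gen q) (fun u => (u == s')%:R) s.
Proof.
rewrite -kernel_pow_sum (bigD1 s')//= eqxx mulr1 big1 ?addr0// => u us.
by rewrite (negPf us) mulr0.
Qed.

(** The factor 2 comes from [`|f u - f s| <= 2 * M]. *)
Definition rate_bound q : R := \sum_(s : S) \sum_(u : S) 2 * `|q s u|.

Lemma rate_bound_ge0 q : 0 <= rate_bound q.
Proof. by apply: sumr_ge0 => s _; apply: sumr_ge0 => u _; rewrite mulr_ge0. Qed.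

Lemma gen_norm_le q f M : (forall s, `|f s| <= M) ->
  forall s, `|gen q f s| <= rate_bound q * M.
Proof.
move=> fM s; have M0 : 0 <= M by exact: le_trans (fM s).
have -> : rate_bound q * M
    = \sum_(s' : S) \sum_(u : S) 2 * `|q s' u| * M.
  by rewrite mulr_suml; under eq_bigr do rewrite mulr_suml.
apply: le_trans (ler_norm_sum _ _ _) _.
rewrite [leRHS](bigD1 s)//= -[leLHS]addr0 lerD//; last first.
  by do 2![apply: sumr_ge0 => ? _]; rewrite !mulr_ge0.
apply: ler_sum => u _; rewrite normrM [2 * _]mulrC -mulrA ler_wpM2l//.
by rewrite (le_trans (ler_normB _ _))// mulr_natl mulr2n lerD.
Qed.

Lemma iter_gen_norm_le q f M : (forall s, `|f s| <= M) ->
  forall k s, `|iter k (gen q) f s| <= rate_bound q ^+ k * M.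
Proof.
move=> fM; elim=> [|k IH] s; first by rewrite mul1r.
by rewrite iterS exprS -mulrA gen_norm_le.
Qed.

Definition exp_term q t f s (k : nat) : R := t ^+ k / k`!%:R * iter k (gen q) f s.

Lemma is_cvg_exp_term q t f s : cvgn (series (exp_term q t f s)).
Proof.
pose M := \sum_(u : S) `|f u|.
have fM u : `|f u| <= M.
  by rewrite /M (bigD1 u)//= lerDl sumr_ge0.
have M0 : 0 <= M by exact: le_trans (fM s).
pose c := exp_coeff (`|t| * rate_bound q).
have le_c k : `|exp_term q t f s k| <= (M *: c) k.
  rewrite /exp_term !normrM normfV normrX normr_nat.
  rewrite [leRHS](_ : _ = `|t| ^+ k / k`!%:R * (rate_bound q ^+ k * M)).
    by rewrite ler_wpM2l// ?iter_gen_norm_le// divr_ge0// exprn_ge0.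
  by rewrite /c /exp_coeff fctE /= /GRing.scale /= exprMn; ring.
apply: normed_cvg.
apply: (@series_le_cvg _ _ (M *: c)).
- by move=> k; exact: normr_ge0.
- move=> k; rewrite /c /exp_coeff /= mulr_ge0// divr_ge0// exprn_ge0//.
  by rewrite mulr_ge0// rate_bound_ge0.
- exact: le_c.
- by apply: is_cvg_seriesZ; exact: is_cvg_series_exp_coeff.
Qed.

(** Applying the exponential series to a function replaces the powers of the
    matrix by iterates of [gen], on which lumping and absorption are plain
    inductions. *)
Lemma transition_sum q t f s :
  \sum_(u : S) transition q t s u * f u = limn (series (exp_term q t f s)).
Proof.
apply/esym/cvg_lim => //.
have -> : series (exp_term q t f s) = (fun N => \sum_(u : S)
    series (exp_term q t (fun v => (v == u)%:R) s) N * f u).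
  apply/funext => N; rewrite /series /=.
  under [RHS]eq_bigr do rewrite mulr_suml.
  rewrite exchange_big; apply: eq_bigr => k _ /=.
  rewrite /exp_term -kernel_pow_sum mulr_sumr; apply: eq_bigr => u _.
  by rewrite -kernel_powE mulrA.
apply: cvg_big => [|u _]; first by move=> x; exact: add_continuous.
apply: cvgMl; rewrite /transition.
under [in limn _]eq_fun do rewrite kernel_powE.
exact: is_cvg_exp_term.
Qed.

Lemma transitionE q t s s' :
  transition q t s s' = limn (series (exp_term q t (fun u => (u == s')%:R) s)).
Proof.
rewrite -transition_sum (bigD1 s')//= eqxx mulr1 big1 ?addr0// => u us.
by rewrite (negPf us) mulr0.
Qed.

Definition second_order q : R :=
  rate_bound q ^+ 2 * limn (series (exp_coeff (rate_bound q))).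

(** For [h <= 1] all terms of the exponential series beyond the first order
    share the factor [h ^+ 2], and the remaining factors are dominated by the
    exponential series at [rate_bound q]. *)
Lemma transition_taylor q f h s : (forall u, `|f u| <= 1) -> 0 <= h <= 1 ->
  `|\sum_(u : S) transition q h s u * f u - (f s + h * gen q f s)|
    <= second_order q * h ^+ 2.
Proof.
move=> f1 /andP[h0 h1]; set K := rate_bound q.
have K0 : 0 <= K by exact: rate_bound_ge0.
rewrite transition_sum; set a := exp_term q h f s.
have ca : cvgn (series a) by exact: is_cvg_exp_term.
have -> : f s + h * gen q f s = series a 2%N.
  by rewrite /series /= big_nat_recr//= big_nat1 /a /exp_term /=
    expr0 expr1 !invr1 !mulr1 mul1r.
have cB : (fun n => `|series a n - series a 2%N|) @ \oo
    --> `|limn (series a) - series a 2%N|.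
  by apply: cvg_norm; apply: cvgB => //; exact: cvg_cst.
apply: (cvgr_to_le cB); exists 2%N => // n /= n2.
rewrite sub_series_geq// (le_trans (ler_norm_sum _ _ _))//.
rewrite -{1}[2%N]add0n big_addn.
apply: (@le_trans _ _ (h ^+ 2 * K ^+ 2 * series (exp_coeff K) (n - 2)%N)).
  rewrite /series /= mulr_sumr; apply: ler_sum => k _.
  rewrite /a /exp_term !normrM normfV normrX normr_nat ger0_norm//.
  rewrite (_ : _ * _ * exp_coeff K k = h ^+ 2 / k`!%:R * (K ^+ (k + 2))); last first.
    by rewrite /exp_coeff /= exprD; ring.
  rewrite ler_pM ?divr_ge0 ?exprn_ge0//; last first.
    by rewrite (le_trans (iter_gen_norm_le _ f1 _ _))// mulr1.
  rewrite ler_pM ?exprn_ge0 ?invr_ge0//.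
    by rewrite exprD -[leRHS]mul1r ler_wpM2r ?exprn_ge0// exprn_ile1.
  by rewrite lef_pV2 ?posrE ?ltr0n ?fact_gt0// ler_nat leq_fact// leq_addr.
rewrite /second_order -/K [leRHS]mulrC [leRHS]mulrA ler_wpM2l//.
  by rewrite mulr_ge0 ?exprn_ge0.
apply: nondecreasing_cvgn_le; last exact: is_cvg_series_exp_coeff.
by apply: nondecreasing_series => k _ _; exact: exp_coeff_ge0.
Qed.

End TransitionFunction.

Section Lumping.
Context {R : realType} {S T : finType}.
Implicit Types (q : S -> S -> R) (phi : S -> T).

(** Iterates of the generator preserve the functions that factor through
    [phi], hence so does the exponential series. *)
Lemma lumped_transition q (q' : T -> T -> R) phi :
  (forall f s, gen q (f \o phi) s = gen q' f (phi s)) ->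
  forall t f s, \sum_(u : S) transition q t s u * f (phi u)
    = \sum_(v : T) transition q' t (phi s) v * f v.
Proof.
move=> lump t f s; rewrite !transition_sum; congr (limn (series _)).
apply/funext => k; rewrite /exp_term; congr (_ * _).
elim: k s => [//|k IH] s; rewrite !iterS -lump.
by congr (gen q _ s); apply/funext => u /=; rewrite IH.
Qed.

(** A function vanishing on [C] is sent by the generator to a function
    vanishing on [C], when no jump leaves [C]. *)
Lemma transition_support q (C : pred S) :
  (forall s u, C s -> ~~ C u -> q s u = 0) ->
  forall t s u, C s -> ~~ C u -> transition q t s u = 0.
Proof.
move=> q0 t s u Cs Cu; rewrite transitionE.
have it0 k : forall v, C v -> iter k (gen q) (fun w => (w == u)%:R) v = 0.
  elim: k => [|k IH] v Cv /=.
    by case: eqP => // vu; rewrite -vu Cv in Cu.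
  rewrite /gen big1// => w _; have [Cw|Cw] := boolP (C w).
    by rewrite !IH// subrr mulr0.
  by rewrite q0// mul0r.
rewrite (_ : series _ = cst 0) ?lim_cst//; apply/funext => N.
by rewrite /series /= big1// => k _; rewrite /exp_term it0// mulr0.
Qed.

End Lumping.

Lemma transition0 (R : realType) (S : finType) (q : S -> S -> R) s u :
  transition q 0 s u = (s == u)%:R.
Proof.
pose f v : R := (v == u)%:R.
have f1 v : `|f v| <= 1 by rewrite /f; case: eqP => _; rewrite ?normr1 ?normr0.
have := @transition_taylor R S q f 0 s f1; rewrite lexx ler01 => /(_ isT).
rewrite expr0n mulr0 mul0r addr0 normr_le0 subr_eq0 => /eqP e.
rewrite -[RHS]/(f s) -e.
by rewrite transition_sum -transitionE.
Qed.

(** * Survival of the number of unmatched coordinates *)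

Section DeathChain.
Context {R : realType}.
Implicit Types (t x lam : R) (p : {poly R}) (m k N : nat).

(** The distribution function of an exponential time of rate 2, in which all
    the hitting laws below are polynomials. *)
Definition flip_cdf t : R := 1 - expR (- (2 * t)).

Lemma flip_cdf0 : flip_cdf 0 = 0.
Proof. by rewrite /flip_cdf mulr0 oppr0 expR0 subrr. Qed.

Lemma flip_cdf_ge0 t : 0 <= t -> 0 <= flip_cdf t.
Proof. by move=> t0; rewrite subr_ge0 -expR0 ler_expR oppr_le0 mulr_ge0. Qed.

Lemma flip_cdf_le1 t : flip_cdf t <= 1.
Proof. by rewrite lerBlDr lerDl expR_ge0. Qed.

Lemma is_derive_flip_cdf t : is_derive t 1 flip_cdf (2 * (1 - flip_cdf t)).
Proof.
have -> : flip_cdf = cst 1 - (expR \o (fun s => - (2 *: s))) by [].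
apply: is_derive_eq; rewrite !fctE /= /GRing.scale /=; ring.
Qed.

Lemma is_derive_horner_flip p t :
  is_derive t 1 (fun s => p.[flip_cdf s])
    (2 * ((1 - flip_cdf t) * p^`().[flip_cdf t])).
Proof.
have dq := is_derive_flip_cdf t.
by apply: is_derive_eq (is_derive1_comp _ dq) _; rewrite mulrA mulrC.
Qed.

(** The product of [f] with [expR (lam * t)] is nondecreasing. *)
Lemma gronwall_ge0 (f df : R -> R) lam :
  (forall t, is_derive t 1 f (df t)) -> 0 <= f 0 ->
  (forall t, 0 <= t -> 0 <= df t + lam * f t) ->
  forall t, 0 <= t -> 0 <= f t.
Proof.
move=> fdf f0 dfge t t0.
pose g : R -> R := f * (expR \o (fun s : R => lam *: s)).
have gd (s : R) : is_derive s 1 g ((df s + lam * f s) * expR (lam * s)).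
  by apply: is_derive_eq; rewrite /= /GRing.scale /=; ring.
have : g 0 <= g t.
  apply: (@ger0_derive1_ndecr _ g 0 t) => //.
  - move=> s; rewrite in_itv/= => /andP[/ltW s0 _].
    by have ds := gd s; rewrite derive1E derive_val mulr_ge0 ?dfge ?expR_ge0.
  - apply: derivable_within_continuous => s _; by case: (gd s).
rewrite /g !fctE scaler0 expR0 mulr1 => /(le_trans f0).
by rewrite pmulr_lge0 ?expR_gt0.
Qed.

(** Since the derivative of [flip_cdf] is [2 * (1 - flip_cdf)], differential
    inequalities in time reduce to inequalities between polynomials on [0, 1]. *)
Lemma horner_flip_ge0 p lam : 0 <= p.[0] ->
  (forall x, 0 <= x -> x <= 1 -> 0 <= (1 - x) * p^`().[x] + lam * p.[x]) ->
  forall t, 0 <= t -> 0 <= p.[flip_cdf t].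
Proof.
move=> p0 pge.
apply: (@gronwall_ge0 _ _ (2 * lam) (is_derive_horner_flip p)).
- by rewrite /= flip_cdf0.
- move=> t t0; rewrite /= -[2 * lam * _]mulrA -mulrDr mulr_ge0// pge ?flip_cdf_le1//.
  exact: flip_cdf_ge0.
Qed.

(** The equation of [odd_cdf_ode], with initial value 0, solved degree by
    degree. *)
Fixpoint odd_coef m j : R :=
  if j is i.+1 then
    (m.*2.+1%:R * ((i == m)%:R - odd_coef m i) + i%:R * odd_coef m i) / i.+1%:R
  else 0.

(** Past degree [m] the recurrence is [c_(j+1) = (j - (2 m + 1)) / (j + 1) c_j],
    so that it stops at [j = 2 m + 1] and the solution is a polynomial. *)
Lemma odd_coef_vanish m j : (m.*2.+2 <= j)%N -> odd_coef m j = 0.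
Proof.
move=> /subnK <-; elim: (j - _)%N => [|i IH].
  rewrite add0n /= (_ : (_ == m) = false); last by apply/eqP; lia.
  by rewrite sub0r mulrN addNr mul0r.
rewrite addSn /= IH (_ : (_ == m) = false); last by apply/eqP; lia.
by rewrite subrr !mulr0 addr0 mul0r.
Qed.

Definition odd_cdf m : {poly R} := \poly_(j < m.*2.+2) odd_coef m j.

Lemma coef_odd_cdf m j : (odd_cdf m)`_j = odd_coef m j.
Proof. by rewrite coef_poly; case: ltnP => // /odd_coef_vanish. Qed.

Lemma odd_cdf_ode m :
  (1 - 'X) * (odd_cdf m)^`() = m.*2.+1%:R *: ('X^m - odd_cdf m).
Proof.
have dE j : (odd_cdf m)^`()`_j
    = m.*2.+1%:R * ((j == m)%:R - odd_coef m j) + j%:R * odd_coef m j.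
  rewrite coef_deriv coef_odd_cdf -[_ *+ j.+1]mulr_natr.
  by rewrite [LHS]mulfVK ?pnatr_eq0.
apply/polyP => j; rewrite mulrBl mul1r mulrC coefB coefMX dE.
rewrite coefZ coefB coefXn !coef_odd_cdf.
case: j => [|j]; first by rewrite mul0r addr0 subr0.
rewrite coef_deriv coef_odd_cdf; move: (odd_coef m) => c /=.
by rewrite -[c j.+1 *+ j.+1]mulr_natl addrK mulr_natl.
Qed.

Lemma odd_cdf_at0 m : (odd_cdf m).[0] = 0.
Proof. by rewrite horner_coef0 coef_odd_cdf. Qed.

(** The law of the time that [N] unmatched coordinates need to disappear under
    the strategy, as a polynomial in [flip_cdf]. For [N = 2 m] the successive
    times are exponential of rates [2 m], ..., [4], [2], and their sum is
    distributed like the maximum of [m] exponential times of rate 2; for odd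
    [N] a first time of rate [2 N] is added. *)
Definition hit_cdf N : {poly R} := if odd N then odd_cdf N./2 else 'X^(N./2).

(** The loss of survival probability per flipped coordinate: the strategy
    flips one unmatched coordinate at a time if [N] is odd, two if it is even. *)
Definition hit_gap N : {poly R} :=
  if odd N then hit_cdf N.-1 - hit_cdf N
  else 2^-1 *: (hit_cdf N.-2 - hit_cdf N).

Lemma hit_cdf_even m : hit_cdf m.*2 = 'X^m.
Proof. by rewrite /hit_cdf odd_double doubleK. Qed.

Lemma hit_cdf_odd m : hit_cdf m.*2.+1 = odd_cdf m.
Proof. by rewrite /hit_cdf /= odd_double /= uphalf_double. Qed.

Lemma parityP (Q : nat -> Prop) :
  (forall m, Q m.*2) -> (forall m, Q m.*2.+1) -> forall N, Q N.
Proof.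
by move=> Qe Qo N; rewrite -(odd_double_half N); case: (odd N); [exact: Qo|exact: Qe].
Qed.

(** The backward equation of the death chain, in the variable [flip_cdf]. In
    both parities the coordinates of the two walks are flipped at total rate
    [2 N], which is where the uniform factor [N] comes from. *)
Lemma hit_cdf_ode N : (1 - 'X) * (hit_cdf N)^`() = N%:R *: hit_gap N.
Proof.
move: N; apply: parityP => m; rewrite /hit_gap /= odd_double /=; last first.
  by rewrite hit_cdf_odd hit_cdf_even odd_cdf_ode.
case: m => [|m]; first by rewrite hit_cdf_even derivC mulr0 scale0r.
rewrite !hit_cdf_even derivXn -mulr_natl scalerA -muln2 natrM mulfK//=.
rewrite exprS -mul_polyC polyCMn; ring.
Qed.

Lemma hit_cdf_at0 N : (0 < N)%N -> (hit_cdf N).[0] = 0.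
Proof.
move: N; apply: parityP => m; rewrite ?hit_cdf_odd ?odd_cdf_at0// hit_cdf_even.
by case: m => // m _; rewrite hornerXn expr0n.
Qed.

Let odd_ode_at m x :
  (1 - x) * (odd_cdf m)^`().[x] = m.*2.+1%:R * (x ^+ m - (odd_cdf m).[x]).
Proof.
by have := congr1 (horner^~ x) (odd_cdf_ode m); rewrite !hornerE.
Qed.

Let natS2 m : m.*2.+1%:R = 2 * m%:R + 1 :> R.
Proof. by rewrite -muln2 -natr1 natrM mulrC. Qed.

(** The two inequalities that follow compare consecutive hitting laws: in the
    variable [x = flip_cdf t], the difference [p] satisfies
    [(1 - x) p' + (2 m + 1) p >= 0]. *)
Let odd_le_even m t : 0 <= t ->
  (hit_cdf m.*2.+1).[flip_cdf t] <= (hit_cdf m.*2).[flip_cdf t].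
Proof.
move=> t0; rewrite hit_cdf_odd hit_cdf_even -subr_ge0 -hornerN -hornerD.
move: t t0; apply: (@horner_flip_ge0 _ m.*2.+1%:R).
  by rewrite !hornerE odd_cdf_at0 subr0 exprn_ge0.
move=> x x0 x1; rewrite derivB derivXn !(hornerE, hornerMn) mulrBr odd_ode_at.
rewrite [leRHS](_ : _ = (1 - x) * (x ^+ m.-1 *+ m)); last by ring.
by rewrite mulr_ge0 ?subr_ge0// mulrn_wge0// exprn_ge0.
Qed.

Let even_le_odd m t : 0 <= t ->
  (hit_cdf m.*2.+2).[flip_cdf t] <= (hit_cdf m.*2.+1).[flip_cdf t].
Proof.
move=> t0; rewrite hit_cdf_odd -doubleS hit_cdf_even -subr_ge0 -hornerN -hornerD.
move: t t0; apply: (@horner_flip_ge0 _ m.*2.+1%:R).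
  by rewrite !hornerE odd_cdf_at0 expr0n/= subr0.
move=> x x0 x1; rewrite derivB derivXn !(hornerE, hornerMn) mulrBr odd_ode_at.
rewrite [leRHS](_ : _ = m%:R * (x ^+ m * (1 - x))).
  by rewrite mulr_ge0// mulr_ge0 ?subr_ge0// exprn_ge0.
by rewrite natS2 -mulr_natl -natr1 /= exprS; ring.
Qed.

Lemma hit_cdf_decr N t : 0 <= t ->
  (hit_cdf N.+1).[flip_cdf t] <= (hit_cdf N).[flip_cdf t].
Proof. by move: N; apply: parityP => m; [exact: odd_le_even|exact: even_le_odd]. Qed.

(** From the even state [2 m + 2], flipping a pair of unmatched coordinates
    gains at least twice as much as flipping one. *)
Lemma hit_cdf_even_convex m t : 0 <= t ->
  2 * (hit_cdf m.*2.+1).[flip_cdf t]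
    <= (hit_cdf m.*2).[flip_cdf t] + (hit_cdf m.*2.+2).[flip_cdf t].
Proof.
move=> t0; rewrite hit_cdf_odd -doubleS !hit_cdf_even -subr_ge0.
rewrite -hornerD -hornerZ -hornerN -hornerD.
move: t t0; apply: (@horner_flip_ge0 _ m.*2.+1%:R).
  by rewrite !hornerE odd_cdf_at0 mulr0 subr0 addr_ge0// exprn_ge0.
move=> x x0 x1; rewrite derivB derivD derivZ !derivXn !(hornerE, hornerMn).
rewrite [leRHS](_ : _ = (1 - x) * (x ^+ m.-1 *+ m + m.+1%:R * x ^+ m)
   - 2 * ((1 - x) * (odd_cdf m)^`().[x])
   + m.*2.+1%:R * (x ^+ m + x ^+ m.+1 - 2 * (odd_cdf m).[x])); last first.
  by rewrite -mulr_natl /=; ring.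
rewrite odd_ode_at.
case: m => [|m].
  rewrite expr1 expr0 mulr0n double0; lra.
rewrite [leRHS](_ : _ = m.+1%:R * (x ^+ m * (1 - x) ^+ 2)).
  by rewrite mulr_ge0// mulr_ge0 ?exprn_ge0 ?subr_ge0.
by rewrite natS2 -mulr_natl -!natr1 /= !exprS; ring.
Qed.

(** From the odd state [2 m + 3], flipping a pair of unmatched coordinates gains
    at most twice as much as flipping one. The source term of the differential
    inequality is exactly the inequality for even states. *)
Lemma hit_cdf_odd_concave m t : 0 <= t ->
  (hit_cdf m.*2.+1).[flip_cdf t] + (hit_cdf m.*2.+3).[flip_cdf t]
    <= 2 * (hit_cdf m.*2.+2).[flip_cdf t].
Proof.
move=> t0.
pose p : {poly R} := 2 *: 'X^(m.+1) - (odd_cdf m + odd_cdf m.+1).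
suff: 0 <= p.[flip_cdf t].
  by rewrite -!doubleS !hit_cdf_odd !hit_cdf_even !hornerE subr_ge0.
move: t t0.
apply: (@gronwall_ge0 _ _ (2 * m.*2.+3%:R) (is_derive_horner_flip p)).
  by rewrite /p flip_cdf0 !hornerE !odd_cdf_at0 expr0n/=; lra.
move=> s s0 /=; set x := flip_cdf s.
have le : 2 * (odd_cdf m).[x] <= x ^+ m + x ^+ m.+1.
  have := hit_cdf_even_convex m s0.
  by rewrite -!doubleS !hit_cdf_odd !hit_cdf_even !hornerE.
have -> : p.[x] = 2 * x ^+ m.+1 - ((odd_cdf m).[x] + (odd_cdf m.+1).[x]).
  by rewrite /p !hornerE.
have -> : p^`().[x] = 2 * (m.+1%:R * x ^+ m)
    - ((odd_cdf m)^`().[x] + (odd_cdf m.+1)^`().[x]).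
  rewrite /p derivB derivD derivZ derivXn hornerD hornerN hornerZ hornerD.
  by rewrite hornerMn hornerXn [m.+1%:R * _]mulr_natl.
rewrite [(1 - x) * (_ - _)]mulrBr [(1 - x) * (_^`().[x] + _)]mulrDr.
have e3 : m.*2.+3%:R = 2 * m%:R + 3 :> R.
  by rewrite -doubleS natS2 -natr1; ring.
rewrite !odd_ode_at e3 !natS2 -natr1.
move: le; rewrite !exprS; nra.
Qed.

Definition surv N t : R := 1 - (hit_cdf N).[flip_cdf t].

Definition surv_gap N t : R := (hit_gap N).[flip_cdf t].

Lemma surv_gapE N t : surv_gap N t =
  if odd N then surv N t - surv N.-1 t else 2^-1 * (surv N t - surv N.-2 t).
Proof.
rewrite /surv_gap /hit_gap /surv; case: ifP => _.
  by rewrite hornerD hornerN; ring.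
by rewrite hornerZ hornerD hornerN; congr (_ * _); ring.
Qed.

Lemma surv0 t : surv 0 t = 0.
Proof. by rewrite /surv (hit_cdf_even 0) expr0 hornerC subrr. Qed.

Lemma surv_at0 N : (0 < N)%N -> surv N 0 = 1.
Proof. by move=> N0; rewrite /surv flip_cdf0 hit_cdf_at0// subr0. Qed.

Lemma surv_homo t : 0 <= t -> {homo surv^~ t : N M / (N <= M)%N >-> N <= M}.
Proof.
move=> t0; apply: homo_leq => [N|M N K|N]; [exact: lexx|exact: le_trans|].
by rewrite lerD2l lerN2 hit_cdf_decr.
Qed.

Lemma surv_ge0 N t : 0 <= t -> 0 <= surv N t.
Proof. by move=> t0; rewrite -(surv0 t) surv_homo. Qed.

Lemma surv_le1 N t : 0 <= t -> surv N t <= 1.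
Proof.
move=> t0; apply: (@le_trans _ _ (surv N.*2 t)).
  by apply: surv_homo => //; rewrite -addnn leq_addr.
by rewrite /surv hit_cdf_even hornerXn gerBl exprn_ge0 ?flip_cdf_ge0.
Qed.

Lemma surv_gap_ge0 N t : 0 <= t -> 0 <= surv_gap N t.
Proof.
move=> t0; rewrite surv_gapE; case: ifP => _.
  by rewrite subr_ge0 surv_homo// leq_pred.
by rewrite mulr_ge0// subr_ge0 surv_homo//; lia.
Qed.

Lemma surv_gap_le1 N t : 0 <= t -> surv_gap N t <= 1.
Proof.
move=> t0; rewrite surv_gapE; have := surv_le1 N t0.
have := surv_ge0 N.-1 t0; have := surv_ge0 N.-2 t0.
by case: ifP => _; lra.
Qed.

Lemma surv_slope1 N t : 0 <= t -> surv N t - surv_gap N t <= surv N.-1 t.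
Proof.
move=> t0; rewrite surv_gapE; move: N; apply: parityP => m.
  rewrite odd_double; case: m => [|m]; first by rewrite surv0; lra.
  by have := hit_cdf_even_convex m t0; rewrite doubleS /= /surv; lra.
by rewrite /= odd_double /=; lra.
Qed.

Lemma surv_slope2 N t : 0 <= t -> surv N t - 2 * surv_gap N t <= surv N.-2 t.
Proof.
move=> t0; rewrite surv_gapE; move: N; apply: parityP => m.
  by rewrite odd_double; lra.
rewrite /= odd_double /=; case: m => [|m].
  by rewrite !surv0; have := surv_ge0 1 t0; lra.
by have := hit_cdf_odd_concave m t0; rewrite doubleS /= /surv; lra.
Qed.

(** The optimality of the strategy in one inequality: [k] is the number of flips
    of unmatched coordinates, and flips of matched ones can only increase the
    number [M] of unmatched coordinates after the move. *)
Lemma surv_flips N M k t : 0 <= t -> (k <= 2)%N -> (N <= M + k)%N ->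
  surv N t - k%:R * surv_gap N t <= surv M t.
Proof.
move=> t0; case: k => [|[|[|//]]] _ NM.
- by rewrite mul0r subr0 surv_homo// -(addn0 M).
- by rewrite mul1r (le_trans (surv_slope1 N t0))// surv_homo//; lia.
- by rewrite (le_trans (surv_slope2 N t0))// surv_homo//; lia.
Qed.

Lemma is_derive_surv N t :
  is_derive t 1 (surv N) (- (2 * N%:R * surv_gap N t)).
Proof.
have dh := is_derive_horner_flip (hit_cdf N) t.
have -> : surv N = cst 1 - (fun s => (hit_cdf N).[flip_cdf s]) by [].
apply: is_derive_eq; rewrite sub0r; congr (- _).
have := congr1 (horner^~ (flip_cdf t)) (hit_cdf_ode N).
by rewrite /surv_gap hornerM hornerZ hornerD hornerN hornerX hornerC -mulrA => ->.
Qed.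

Lemma surv_mvt N t h : 0 <= t -> 0 <= h -> exists2 c, 0 <= c - t <= h &
  surv N (t + h) - surv N t = - (2 * N%:R * surv_gap N c) * h.
Proof.
move=> t0 h0; have th : t <= t + h by rewrite lerDl.
have [|c] := @MVT_segment R (surv N) _ t (t + h) th (fun c _ => is_derive_surv N c).
- apply: derivable_within_continuous => s _.
  by case: (is_derive_surv N s).
- rewrite in_itv/= (_ : t + h - t = h); last by ring.
  move=> /andP[tc ch] e.
  by exists c => //; rewrite subr_ge0 tc lerBlDl.
Qed.

Lemma surv_lip N t h : 0 <= t -> 0 <= h ->
  `|surv N (t + h) - surv N t| <= 2 * N%:R * h.
Proof.
move=> t0 h0; have [c /andP[tc ch] ->] := surv_mvt N t0 h0.
have c0 : 0 <= c by lra.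
have g0 := surv_gap_ge0 N c0; have g1 := surv_gap_le1 N c0.
rewrite mulNr normrN !normrM (ger0_norm h0) (ger0_norm g0) !normr_nat.
by rewrite -mulrA ler_wpM2l ?mulr_ge0// -[leRHS]mul1r ler_wpM2r.
Qed.

Lemma surv_gap_lip N t h : 0 <= t -> 0 <= h ->
  `|surv_gap N (t + h) - surv_gap N t| <= 4 * N%:R * h.
Proof.
move=> t0 h0; have lip M : (M <= N)%N ->
    `|surv M (t + h) - surv M t| <= 2 * N%:R * h.
  move=> MN; apply: le_trans (surv_lip M t0 h0) _.
  by rewrite ler_wpM2r// ler_wpM2l// ler_nat.
have /ler_normlP[a1 a2] := lip N (leqnn N).
have /ler_normlP[b1 b2] := lip N.-1 (leq_pred N).
have /ler_normlP[c1 c2] := lip N.-2 (leq_trans (leq_pred _) (leq_pred _)).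
by rewrite !surv_gapE; case: ifP => _; apply/ler_normlP; split; lra.
Qed.

(** The error is uniform in [t] because the derivative of [surv N] is a multiple
    of [surv_gap N], which is Lipschitz like the survival functions. *)
Lemma surv_taylor N t h : 0 <= t -> 0 <= h ->
  `|surv N (t + h) - (surv N t - 2 * N%:R * surv_gap N t * h)|
    <= 8 * N%:R ^+ 2 * h ^+ 2.
Proof.
move=> t0 h0; have [c /andP[tc ch] e] := surv_mvt N t0 h0.
rewrite (_ : _ - _ = - (2 * N%:R * h * (surv_gap N (t + (c - t)) - surv_gap N t))).
  rewrite normrN normrM ger0_norm ?mulr_ge0//.
  have -> : 8 * N%:R ^+ 2 * h ^+ 2 = 2 * N%:R * h * (4 * N%:R * h) by ring.
  rewrite ler_wpM2l ?mulr_ge0// (le_trans (surv_gap_lip N t0 tc))//.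
  by rewrite ler_wpM2l// mulr_ge0.
by rewrite opprB addrA addrAC e [t + _]addrC subrK; ring.
Qed.

End DeathChain.

(** * One step of a coupling on the hypercube *)

Section HypercubeRates.
Context {R : realType} {n : nat}.
Local Open Scope set_scope.
Implicit Types (x y z : hypercube n) (i j : 'I_n).

Let flipE x i j : (x + unit_vec i) j = if j == i then x j + 1 else x j.
Proof. by rewrite !ffunE; case: eqP => // _; rewrite addr0. Qed.

Let flip_neq (a : 'Z_2) : (a == a + 1) = false.
Proof. by case: a => [[|[|//]] ?]. Qed.

Let flip_neqP (a b : 'Z_2) : a != b -> a + 1 = b.
Proof. by case: a b => [[|[|//]] ?] [[|[|//]] ?] // _; apply/val_inj. Qed.

Lemma unmatched_refl x : unmatched x x = finset.set0.
Proof. by apply/setP => j; rewrite !inE eqxx. Qed.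

Lemma unmatchedC x y : unmatched x y = unmatched y x.
Proof. by apply/setP => j; rewrite !inE eq_sym. Qed.

Lemma unmatched_eq0 x y : (#|unmatched x y| == 0)%N = (x == y).
Proof.
rewrite cards_eq0; apply/eqP/eqP => [/setP xy|->].
  by apply/ffunP => j; have := xy j; rewrite !inE => /negbFE/eqP.
by apply/setP => j; rewrite !inE eqxx.
Qed.

Lemma card_unmatched_le x y : (#|unmatched x y| <= n)%N.
Proof. by rewrite -[leqRHS]card_ord max_card. Qed.

Lemma unmatched_flip x i : unmatched x (x + unit_vec i) = [set i].
Proof.
apply/setP => j; rewrite !inE flipE; case: (j =P i) => _; last by rewrite eqxx.
by rewrite flip_neq.
Qed.

Lemma unmatched_flip2 x y i :
  unmatched (x + unit_vec i) (y + unit_vec i) = unmatched x y.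
Proof.
apply/setP => j; rewrite !inE !flipE; case: (j =P i) => // _.
by rewrite (inj_eq (addIr _)).
Qed.

Lemma unmatched_flipl x y i : i \in unmatched x y ->
  unmatched (x + unit_vec i) y = unmatched x y :\ i.
Proof.
rewrite inE => xyi; apply/setP => j; rewrite !inE flipE.
by case: (j =P i) => // ->; rewrite (flip_neqP xyi) eqxx.
Qed.

Lemma unmatched_flipr x y j : j \in unmatched x y ->
  unmatched x (y + unit_vec j) = unmatched x y :\ j.
Proof. by rewrite ![unmatched x _]unmatchedC; exact: unmatched_flipl. Qed.

Lemma sum_pred1 (T : finType) (a : T) (F : T -> R) :
  \sum_(u : T) (u == a)%:R * F u = F a.
Proof.
rewrite (bigD1 a)//= eqxx mul1r big1 ?addr0// => u ua.
by rewrite (negPf ua) mul0r.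
Qed.

Lemma sum_indexed_pred1 (T I : finType) (A : pred I) (g : I -> T) (c : R)
    (F : T -> R) :
  \sum_(u : T) (\sum_(i | A i) c * (u == g i)%:R) * F u
    = \sum_(i | A i) c * F (g i).
Proof.
under eq_bigr do rewrite mulr_suml.
rewrite exchange_big; apply: eq_bigr => i _ /=.
by under eq_bigr do rewrite -mulrA; rewrite -mulr_sumr sum_pred1.
Qed.

Lemma gen_walk f x :
  gen (@walk_rate R n) f x = \sum_(i : 'I_n) (f (x + unit_vec i) - f x).
Proof.
rewrite /gen /walk_rate.
under eq_bigr => u _ do under eq_bigr => i _ do rewrite -[_%:R]mul1r.
by rewrite sum_indexed_pred1; apply: eq_bigr => i _; rewrite mul1r.
Qed.

Lemma gen_hat f x y : let U := unmatched x y in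
  gen (@hat_rate R n) f (x, y) =
    \sum_(i in ~: U) (f (x + unit_vec i, y + unit_vec i) - f (x, y))
    + (if odd #|U| then
         \sum_(i in U) ((f (x + unit_vec i, y) - f (x, y))
                        + (f (x, y + unit_vec i) - f (x, y)))
       else
         \sum_(i in U) \sum_(j in U | j != i)
           (#|U|.-1)%:R^-1 * (f (x + unit_vec i, y + unit_vec j) - f (x, y))).
Proof.
rewrite /gen /hat_rate /=; set U := unmatched x y.
under eq_bigr do rewrite mulrDl; rewrite big_split /=; congr (_ + _).
  under eq_bigr => u _ do under eq_bigr => i _ do rewrite -[_%:R]mul1r.
  by rewrite sum_indexed_pred1; apply: eq_bigr => i _; rewrite mul1r.
case: ifP => _; last first.
  under eq_bigr do rewrite mulr_suml.
  rewrite exchange_big; apply: eq_bigr => i _ /=.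
  by rewrite sum_indexed_pred1.
under eq_bigr do rewrite mulr_suml.
rewrite exchange_big; apply: eq_bigr => i _ /=.
by under eq_bigr do rewrite mulrDl; rewrite big_split /= !sum_pred1.
Qed.

(** The [#|U|.-1] choices of a partner compensate the rate of each pair; an even
    [#|U|] with an element [i] is at least 2, so that this rate is finite. *)
Let card_pair_sum (U : {set 'I_n}) (F : 'I_n -> R) : ~~ odd #|U| ->
  \sum_(i in U) \sum_(j in U | j != i) (#|U|.-1)%:R^-1 * F i = \sum_(i in U) F i.
Proof.
move=> oU; apply: eq_bigr => i iU.
rewrite sumr_const; set c := (X in _ *+ X); have -> : c = #|U|.-1.
  rewrite (cardsD1 i U) iU add1n /=.
  by apply: eq_card => j; rewrite !inE andbC.
rewrite -[LHS]mulr_natl mulrA divff ?mul1r// pnatr_eq0.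
by move: oU; rewrite (cardsD1 i U) iU /=; case: #|_|.
Qed.

(** Forgetting the second walk, every coordinate of the first one flips at rate
    1, whatever the parity. *)
Lemma gen_hat_fst (f : hypercube n -> R) (p : hypercube n * hypercube n) :
  gen (@hat_rate R n) (f \o fst) p = gen walk_rate f p.1.
Proof.
case: p => x y; rewrite gen_hat gen_walk /=; set U := unmatched x y.
rewrite [RHS](bigID (mem U)) /= [RHS]addrC; congr (_ + _).
  by apply: eq_bigl => i; rewrite inE.
case: ifPn => oU; last by rewrite card_pair_sum.
by apply: eq_bigr => i _; rewrite subrr addr0.
Qed.

Lemma gen_hat_snd (f : hypercube n -> R) (p : hypercube n * hypercube n) :
  gen (@hat_rate R n) (f \o snd) p = gen walk_rate f p.2.
Proof.
case: p => x y; rewrite gen_hat gen_walk /=; set U := unmatched x y.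
rewrite [RHS](bigID (mem U)) /= [RHS]addrC; congr (_ + _).
  by apply: eq_bigl => i; rewrite inE.
case: ifPn => oU; last first.
  rewrite -[RHS](card_pair_sum _ oU) [RHS](exchange_big_dep (mem U))/=; last first.
    by move=> i j _ /andP[].
  apply: eq_bigr => i iU; apply: eq_bigl => j.
  by rewrite iU /= eq_sym.
by apply: eq_bigr => i _; rewrite subrr add0r.
Qed.

Lemma gen_hat_surv r x y : let N := #|unmatched x y| in
  gen (@hat_rate R n) (fun p => surv #|unmatched p.1 p.2| r) (x, y)
    = - (2 * N%:R * surv_gap N r).
Proof.
rewrite gen_hat /=; set U := unmatched x y.
rewrite big1 ?add0r; last by move=> i _; rewrite unmatched_flip2 subrr.
rewrite surv_gapE; case: ifPn => oU; last first.
  rewrite (eq_bigr (fun i => \sum_(j in U | j != i)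
    (#|U|.-1)%:R^-1 * (surv #|U|.-2 r - surv #|U| r))); last first.
    move=> i iU; apply: eq_bigr => j /andP[jU ji].
    have jU' : j \in unmatched (x + unit_vec i) y.
      by rewrite unmatched_flipl// in_setD1 ji.
    rewrite unmatched_flipr// unmatched_flipl// -/U.
    have -> : (#|U :\ i :\ j| = #|U|.-2)%N.
      by rewrite (cardsD1 i U) iU (cardsD1 j (U :\ i)) in_setD1 ji jU.
    by [].
  by rewrite card_pair_sum// sumr_const -[LHS]mulr_natl; field.
rewrite (eq_bigr (fun=> 2 * (surv #|U|.-1 r - surv #|U| r))); last first.
  move=> i iU; rewrite unmatched_flipl// unmatched_flipr// -/U.
  have -> : (#|U :\ i| = #|U|.-1)%N by rewrite (cardsD1 i U) iU.
  by ring.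
rewrite sumr_const -[LHS]mulr_natl; ring.
Qed.

(** The dual certificate of the one-step transport problem, [U] being the set of
    unmatched coordinates and [x] the position of one of the walks. Positions
    [z] more than one flip away are reached with probability O(h^2), and the
    value -1 makes [potential_add_le] trivial there. *)
Definition potential (U : {set 'I_n}) (r : R) x z : R :=
  if (#|unmatched x z| <= 1)%N then
    surv #|U| r / 2 - #|U :&: unmatched x z|%:R * surv_gap #|U| r
  else -1.

Lemma potential_norm_le U r x z : 0 <= r -> `|potential U r x z| <= 1.
Proof.
move=> r0; rewrite /potential; case: ifPn => [xz1|_]; last by rewrite normrN1.
have s0 := surv_ge0 #|U| r0; have s1 := surv_le1 #|U| r0.
have g0 := surv_gap_ge0 #|U| r0; have g1 := surv_gap_le1 #|U| r0.
have : (#|U :&: unmatched x z| <= 1)%N.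
  by apply: leq_trans xz1; rewrite subset_leq_card// finset.subsetIr.
by case: #|_ :&: _| => [|[|//]] _; apply/ler_normlP; split; lra.
Qed.

Lemma gen_potential U r x :
  gen (@walk_rate R n) (potential U r x) x = - (#|U|%:R * surv_gap #|U| r).
Proof.
rewrite gen_walk (eq_bigr (fun i => if i \in U then - surv_gap #|U| r else 0)).
  by rewrite -big_mkcond sumr_const -[LHS]mulr_natl mulrN.
move=> i _; rewrite /potential unmatched_flip cards1.
rewrite unmatched_refl finset.setI0 cards0 /=; case: ifPn => iU.
  have -> : U :&: [set i] = [set i] by apply/finset.setIidPr; rewrite finset.sub1set.
  by rewrite cards1; ring.
have -> : U :&: [set i] = finset.set0.
  by apply/eqP; rewrite finset.setI_eq0 disjoint_sym disjoints1.
by rewrite cards0 subrr.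
Qed.

(** Each flip of a coordinate of [U] by either walk lowers one of the two
    potentials by [surv_gap], while a coordinate can only leave [U] when one of
    the walks flips it. *)
Lemma potential_add_le x y z z' r : 0 <= r ->
  potential (unmatched x y) r x z + potential (unmatched x y) r y z'
    <= surv #|unmatched z z'| r.
Proof.
move=> r0; set U := unmatched x y.
have u0 := surv_ge0 #|unmatched z z'| r0.
have pot1 v w : potential U r v w <= 1.
  exact: le_trans (ler_norm _) (potential_norm_le _ _ _ r0).
have [xz|xz] := leqP #|unmatched x z| 1; last first.
  by rewrite {1}/potential leqNgt xz /=; have := pot1 y z'; lra.
have [yz|yz] := leqP #|unmatched y z'| 1; last first.
  by rewrite {2}/potential leqNgt yz /=; have := pot1 x z; lra.
rewrite /potential xz yz; set a := #|_ :&: _|; set b := #|_ :&: _|.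
have a1 : (a <= 1)%N.
  by apply: leq_trans xz; rewrite subset_leq_card// finset.subsetIr.
have b1 : (b <= 1)%N.
  by apply: leq_trans yz; rewrite subset_leq_card// finset.subsetIr.
have Uzz : (#|U| <= #|unmatched z z'| + (a + b))%N.
  rewrite addnA; apply: leq_trans (leq_add (leq_card_setU _ _) (leqnn _)).
  apply: leq_trans (leq_card_setU _ _).
  apply/subset_leq_card/fintype.subsetP => i; rewrite !inE => xyi.
  rewrite xyi /=; case: (x i =P z i) => [<-|]; rewrite ?orbT//.
  by case: (y i =P z' i) => [<-|]; rewrite ?orbT// xyi.
have ab2 : (a + b <= 2)%N by rewrite (leq_add a1 b1).
have := surv_flips r0 ab2 Uzz; rewrite natrD; lra.
Qed.

(** Weak duality: the potentials lie below the survival function, and their mean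
    under [pi] depends only on the marginals of [pi], which are those of the
    walk. To first order in [h] this mean is the value of [surv] at the time
    [r + h]. The mass [m] makes the statement usable on the event that the
    walks are at [x] and [y]. *)
Lemma one_step_lower (pi : hypercube n -> hypercube n -> R) (m r h : R) x y :
  0 <= r -> 0 <= h <= 1 -> 0 <= m -> (forall z z', 0 <= pi z z') ->
  (forall z, \sum_z' pi z z' = m * transition walk_rate h x z) ->
  (forall z', \sum_z pi z z' = m * transition walk_rate h y z') ->
  m * (surv #|unmatched x y| (r + h)
       - (2 * second_order (@walk_rate R n) + 8 * n%:R ^+ 2) * h ^+ 2)
    <= \sum_z \sum_z' pi z z' * surv #|unmatched z z'| r.
Proof.
move=> r0 h01 m0 pi0 pix piy; have /andP[h0 h1] := h01.
set U := unmatched x y; set so := second_order _.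
apply: (@le_trans _ _ (\sum_z \sum_z' pi z z' *
    (potential U r x z + potential U r y z'))); last first.
  apply: ler_sum => z _; apply: ler_sum => z' _.
  by rewrite ler_wpM2l// potential_add_le.
have -> : \sum_z \sum_z' pi z z' * (potential U r x z + potential U r y z')
    = m * (\sum_z transition walk_rate h x z * potential U r x z
         + \sum_z transition walk_rate h y z * potential U r y z).
  under eq_bigr do under eq_bigr do rewrite mulrDr.
  under eq_bigr do rewrite big_split; rewrite big_split/= mulrDr.
  congr (_ + _); last rewrite exchange_big.
    rewrite mulr_sumr; apply: eq_bigr => z _.
    by rewrite -mulr_suml pix mulrA.
  rewrite mulr_sumr; apply: eq_bigr => z _.
  by rewrite /= -mulr_suml piy mulrA.
rewrite ler_wpM2l//.
have tx := @transition_taylor R _ walk_rate (potential U r x) h x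
  (fun z => potential_norm_le U x z r0) h01.
have ty := @transition_taylor R _ walk_rate (potential U r y) h y
  (fun z => potential_norm_le U y z r0) h01.
move: tx ty; rewrite !gen_potential -/so => /ler_normlP[tx _] /ler_normlP[ty _].
have pot0 v : potential U r v v = surv #|U| r / 2.
  by rewrite /potential unmatched_refl finset.setI0 cards0 mul0r subr0.
move: tx ty; rewrite !pot0 => tx ty.
have /ler_normlP[_ st] := surv_taylor #|U| r0 h0.
have NN : (#|U|%:R : R) ^+ 2 * h ^+ 2 <= n%:R ^+ 2 * h ^+ 2.
  rewrite ler_wpM2r ?exprn_ge0// lerXn2r ?nnegrE// ler_nat.
  exact: card_unmatched_le.
lra.
Qed.

Lemma one_step_hat (r h : R) x y : 0 <= r -> 0 <= h <= 1 ->
  \sum_z transition hat_rate h (x, y) z * surv #|unmatched z.1 z.2| r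
    <= surv #|unmatched x y| (r + h)
       + (second_order (@hat_rate R n) + 8 * n%:R ^+ 2) * h ^+ 2.
Proof.
move=> r0 h01; have /andP[h0 h1] := h01; set U := unmatched x y.
have := @transition_taylor R _ hat_rate (fun p => surv #|unmatched p.1 p.2| r)
  h (x, y) _ h01.
rewrite gen_hat_surv /= => /(_ _)/ler_normlP[].
  by move=> p; rewrite ger0_norm ?surv_ge0// surv_le1.
rewrite -/U => _ tz; have /ler_normlP[st _] := surv_taylor #|U| r0 h0.
have NN : (#|U|%:R : R) ^+ 2 * h ^+ 2 <= n%:R ^+ 2 * h ^+ 2.
  rewrite ler_wpM2r ?exprn_ge0// lerXn2r ?nnegrE// ler_nat.
  exact: card_unmatched_le.
lra.
Qed.

Lemma hat_diag_absorbing (t : R) x y y' : y != y' ->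
  transition hat_rate t (x, x) (y, y') = 0.
Proof.
move=> yy'; apply: (@transition_support _ _ hat_rate (fun p => p.1 == p.2)) => //=.
move=> [a b] [c d] /= /eqP <- cd.
rewrite unmatched_refl cards0 /= !big_set0 addr0 big1// => i _.
by case: eqP => // -[cE dE]; rewrite cE dE eqxx in cd.
Qed.

End HypercubeRates.

(** * Events depending on finitely many times *)

Section FiniteValued.
Context {R : realType} {d : measure_display} {Omega : measurableType d}.
Context (P : probability Omega R).
Implicit Types (A B E : set Omega).

Definition pr A : R := fine (P A).

Lemma prE A : measurable A -> P A = (pr A)%:E.
Proof. by move=> mA; rewrite fineK// fin_num_measure. Qed.

Lemma pr_ge0 A : 0 <= pr A.
Proof. exact/fine_ge0/measure_ge0. Qed.

Lemma pr_le A B : measurable A -> measurable B -> A `<=` B -> pr A <= pr B.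
Proof.
move=> mA mB AB; rewrite -lee_fin -!prE//.
by apply: le_measure => //; rewrite inE.
Qed.

Context {S : finType} (W : Omega -> S).
Hypothesis mW : forall s, measurable (W @^-1` [set s]).

Lemma measurable_preimage_fin (A : set S) : measurable (W @^-1` A).
Proof.
rewrite (_ : W @^-1` A = \bigcup_(s in A) W @^-1` [set s]).
  by apply: fin_bigcup_measurable => //; exact: finite_finset.
apply/seteqP; split=> [w Aw|w [s As /= ->//]].
by exists (W w).
Qed.

Lemma pr_partition E (A : {set S}) : measurable E ->
  pr (E `&` [set w | W w \in A]) = \sum_(s in A) pr (E `&` W @^-1` [set s]).
Proof.
move=> mE; have mEs s : measurable (E `&` W @^-1` [set s]) by exact: measurableI.
have mr (r : seq S) : measurable (E `&` [set w | W w \in r]).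
  apply: measurableI => //.
  exact: (measurable_preimage_fin [set s | s \in r]).
suff H (r : seq S) : uniq r ->
    pr (E `&` [set w | W w \in r]) = \sum_(s <- r) pr (E `&` W @^-1` [set s]).
  rewrite -big_enum /= -H ?enum_uniq//; congr (pr (_ `&` _)).
  by apply/seteqP; split=> w /=; rewrite mem_enum.
elim: r => [_|s r IH /= /andP[sr ur]].
  rewrite big_nil (_ : _ `&` _ = set0) ?/pr ?measure0//.
  by apply/seteqP; split=> w //= [].
rewrite big_cons -IH//.
rewrite (_ : E `&` _ = (E `&` W @^-1` [set s]) `|` (E `&` [set w | W w \in r])).
  rewrite /pr measureU//; last first.
    apply/seteqP; split=> w //= [[_ /= ->] [_]].
    by rewrite (negPf sr).
  by rewrite fineD// fin_num_measure.
apply/seteqP; split=> w /=.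
  by move=> [Ew]; rewrite inE => /orP[/eqP ->|]; [left|right].
by move=> [[Ew <-]|[Ew wr]]; rewrite inE ?eqxx ?wr ?orbT.
Qed.

Lemma pr_total E : measurable E -> pr E = \sum_s pr (E `&` W @^-1` [set s]).
Proof.
move=> mE; rewrite -{1}(setIT E).
have -> : [set: Omega] = [set w | W w \in [set: S]%SET].
  by apply/seteqP; split=> w //= _; rewrite inE.
by rewrite pr_partition//; apply: eq_bigl => s; rewrite inE.
Qed.

Lemma integral_finite_valued (g : S -> R) B : measurable B ->
  (forall s, 0 <= g s) ->
  (\int[P]_(w in B) (g (W w))%:E
    = (\sum_s g s * pr (B `&` W @^-1` [set s]))%:E)%E.
Proof.
move=> mB g0.
rewrite (eq_integral (fun w => \sum_(s <- index_enum S)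
    (g s)%:E * (\1_(W @^-1` [set s]) w)%:E)%E); last first.
  move=> w _; rewrite (bigD1 (W w))//= big1; last first.
    move=> s sW; rewrite indicE memNset ?mule0//= => Ws.
    by rewrite Ws eqxx in sW.
  by rewrite indicE mem_set// mule1 adde0.
rewrite ge0_integral_sum//; last 2 first.
- move=> s; apply: measurable_funeM.
  by apply/measurable_EFinP; exact: measurable_indic.
- by move=> s w _; rewrite mule_ge0 ?lee_fin.
rewrite -sumEFin; apply: eq_bigr => s _.
rewrite ge0_integralZl//; last 2 first.
- by apply/measurable_EFinP; exact: measurable_indic.
- by rewrite lee_fin.
rewrite integral_indic// EFinM; congr (_ * _)%E.
by rewrite setIC; apply: prE; exact: measurableI.
Qed.

End FiniteValued.

Section FiniteDimensional.
Context {R : realType} {S : finType} {d : measure_display}.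
Context {Omega : measurableType d} (P : probability Omega R).
Context (q : S -> S -> R) (s0 : S) (Z : R -> Omega -> S).
Hypothesis Zchain : is_ctmc P q s0 Z.
Implicit Types (l : seq (R * {set S})) (s t : R) (A : {set S}).

Definition cylinder l : set Omega :=
  [set w | all (fun ta : R * {set S} => Z ta.1 w \in ta.2) l].

Fixpoint box_prob (q : S -> S -> R) t (s : S) l : R :=
  if l is (t', A) :: l' then
    \sum_(s' in A) transition q (t' - t) s s' * box_prob q t' s' l'
  else 1.

Lemma ctmc_measurable t (s : S) : 0 <= t -> measurable (Z t @^-1` [set s]).
Proof. by case: Zchain => + _ _; apply. Qed.

Lemma cylinder_cat l l' : cylinder (l ++ l') = cylinder l `&` cylinder l'.
Proof.
by apply/seteqP; split=> w; rewrite /cylinder /= all_cat;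
  [move/andP|move=> H; apply/andP].
Qed.

Lemma cylinder1 t A : cylinder [:: (t, A)] = [set w | Z t w \in A].
Proof. by apply/seteqP; split=> w; rewrite /cylinder /= andbT. Qed.

Lemma cylinder_single t (s : S) : cylinder [:: (t, [set s]%SET)] = Z t @^-1` [set s].
Proof.
by rewrite cylinder1; apply/seteqP; split=> w /=; rewrite inE => /eqP.
Qed.

Lemma measurable_cylinder l : all (>= 0) (unzip1 l) -> measurable (cylinder l).
Proof.
elim: l => [_|[t A] l IH /= /andP[t0 l0]].
  by rewrite (_ : cylinder [::] = setT)//; apply/seteqP; split.
rewrite -cat1s cylinder_cat cylinder1; apply: measurableI; last exact: IH.
apply: (measurable_preimage_fin (W := Z t) _ [set s | s \in A]).
by move=> s; exact: ctmc_measurable.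
Qed.

Lemma box_prob_split t (s : S) l t' A l' :
  box_prob q t s (l ++ (t', A) :: l')
    = \sum_(s' in A) box_prob q t s (l ++ (t', [set s']%SET) :: l').
Proof.
elim: l t s => [|[t1 A1] l IH] t s /=.
  by apply: eq_bigr => s' _; rewrite big_set1.
rewrite exchange_big; apply: eq_bigr => s1 _ /=.
by rewrite IH mulr_sumr.
Qed.

Let single (ts : R * S) : R * {set S} := (ts.1, [set ts.2]%SET).

Lemma box_prob_single t (s : S) (l : seq (R * S)) :
  box_prob q t s (map single l) = path_prob q t s l.
Proof.
by elim: l t s => [//|[t1 s1] l IH] t s /=; rewrite big_set1 IH.
Qed.

(** The chain axiom gives the probability of being at prescribed points; both
    sides are additive in each set, which is split into points one time after
    the other. *)
Lemma pr_cylinder l : path <=%R 0 (unzip1 l) ->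
  pr P (cylinder l) = box_prob q 0 s0 l.
Proof.
suff H l2 (l1 : seq (R * S)) : path <=%R 0 (unzip1 (map single l1 ++ l2)) ->
    pr P (cylinder (map single l1 ++ l2)) = box_prob q 0 s0 (map single l1 ++ l2).
  by move=> lP; exact: (H l [::]).
have unz1 : unzip1 (map single l1) = unzip1 l1 by rewrite /unzip1 -map_comp.
elim: l2 l1 {unz1} => [|[t A] l2 IH] l1.
  rewrite cats0 box_prob_single /unzip1 -map_comp => l1P.
  case: Zchain => _ _ /(_ l1 l1P) e.
  rewrite /pr (_ : cylinder _ = [set w | all (fun ts => Z ts.1 w == ts.2) l1]) ?e//.
  apply/seteqP; split=> w; rewrite /cylinder /= all_map; apply: sub_all => -[u v] /=;
    by rewrite inE.
move=> lP; have lP' (s : S) :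
    path <=%R 0 (unzip1 (map single (rcons l1 (t, s)) ++ l2)).
  by move: lP; rewrite map_rcons cat_rcons /unzip1 !map_cat.
rewrite box_prob_split.
have c0 : all (>= 0) (unzip1 (map single l1 ++ (t, A) :: l2)).
  by apply: order_path_min lP; exact: le_trans.
move: c0; rewrite /unzip1 map_cat all_cat /= => /and3P[l10 t0 l20].
have mE : measurable (cylinder (map single l1) `&` cylinder l2).
  by apply: measurableI; exact: measurable_cylinder.
transitivity (pr P ((cylinder (map single l1) `&` cylinder l2)
    `&` [set w | Z t w \in A])).
  by rewrite cylinder_cat -cat1s cylinder_cat cylinder1 [X in _ `&` X]setIC setIA.
rewrite pr_partition//; last by move=> s; exact: ctmc_measurable.
apply: eq_bigr => s _; have := IH (rcons l1 (t, s)) (lP' s).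
rewrite map_rcons cat_rcons => <-; rewrite -cylinder_single.
by rewrite cylinder_cat -[single _ :: l2]cat1s cylinder_cat
  [in RHS](setIC _ (cylinder l2)) setIA.
Qed.

End FiniteDimensional.

(** * Functions of a chain that are chains *)

Section LumpedChain.
Context {R : realType} {S T : finType} {d : measure_display}.
Context {Omega : measurableType d} {P : probability Omega R}.
Context {q : S -> S -> R} {q' : T -> T -> R} {s0 : S} {Z : R -> Omega -> S}.
Context {phi : S -> T}.
Hypothesis Zchain : is_ctmc P q s0 Z.
Hypothesis lump : forall f s, gen q (f \o phi) s = gen q' f (phi s).

Let pull (ta : R * {set T}) : R * {set S} := (ta.1, phi @^-1: ta.2)%SET.

Lemma sum_lumped t s (A : {set T}) (g : T -> R) :
  \sum_(u in (phi @^-1: A)%SET) transition q t s u * g (phi u)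
    = \sum_(v in A) transition q' t (phi s) v * g v.
Proof.
rewrite big_mkcond [RHS]big_mkcond /=.
have L := lumped_transition lump t (fun v => if v \in A then g v else 0) s.
have e (U : finType) (a : U -> R) (b : U -> bool) (c : U -> R) :
    \sum_u (if b u then a u * c u else 0) = \sum_u a u * (if b u then c u else 0).
  by apply: eq_bigr => u _; case: ifP; rewrite ?mulr0.
rewrite [RHS]e -L -[RHS]e.
by apply: eq_bigr => u _; rewrite !inE.
Qed.

Lemma box_prob_lumped t s (l : seq (R * {set T})) :
  box_prob q t s (map pull l) = box_prob q' t (phi s) l.
Proof.
elim: l t s => [//|[t' A] l IH] t s /=.
under eq_bigr do rewrite IH.
by rewrite (sum_lumped _ _ _ (fun v => box_prob q' t' v l)).
Qed.

(** The Markov property of the image chain, as an identity between products of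
    transition functions: from any point over [a] the next position over [b]
    has the same probability. *)
Lemma box_prob_markov u s (l : seq (R * {set S})) r t a b :
  box_prob q u s (l ++ [:: pull (r, [set a]%SET); pull (t, [set b]%SET)])
    = transition q' (t - r) a b
      * box_prob q u s (l ++ [:: pull (r, [set a]%SET)]).
Proof.
elim: l u s => [|[u' A] l IH] u s /=; last first.
  rewrite mulr_sumr; apply: eq_bigr => s' _; rewrite IH; ring.
rewrite mulr_sumr; apply: eq_bigr => s'; rewrite !inE => /eqP s'a.
under eq_bigr => v _ do rewrite -[1]/((fun=> 1) (phi v)).
by rewrite (sum_lumped _ _ _ (fun=> 1)) big_set1 s'a; ring.
Qed.

Lemma lumped_is_ctmc : is_ctmc P q' (phi s0) (fun t w => phi (Z t w)).
Proof.
case: (Zchain) => mZ cZ fdd; split.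
- move=> t v t0.
  by apply: (measurable_preimage_fin (fun s => mZ t s t0) [set s | phi s = v]).
- move=> w t t0; have [rc lc] := cZ w t t0; split.
    by apply: filterS rc => u ->.
  by move=> /lc[s sc]; exists (phi s); apply: filterS sc => u ->.
- move=> l lP; pose l' := map (fun ts : R * T => (ts.1, [set ts.2]%SET)) l.
  have e : unzip1 (map pull l') = unzip1 l by rewrite /unzip1 -!map_comp.
  rewrite -box_prob_single -/l' -box_prob_lumped -(pr_cylinder Zchain) ?e//.
  rewrite -prE; last first.
    by apply: (measurable_cylinder Zchain); rewrite e;
      exact: (order_path_min le_trans lP).
  congr (P _); apply/seteqP; split=> w; rewrite /cylinder /= !all_map;
    by apply: sub_all => -[u v] /=; rewrite !inE.
Qed.

(** The times are unordered, which makes this family stable under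
    intersection. *)
Definition natural_generators (s : R) : set (set Omega) :=
  [set B | exists2 l : seq (R * {set S}),
     all (fun r => 0 <= r <= s) (unzip1 l) & B = cylinder Z l].

Definition natural_filtration (s : R) : set (set Omega) :=
  <<s natural_generators s >>.

Lemma natural_generators_measurable s : natural_generators s `<=` measurable.
Proof.
move=> _ [l l0 ->]; apply: (measurable_cylinder Zchain).
by apply: sub_all l0 => r /andP[].
Qed.

Lemma natural_filtration_measurable s : natural_filtration s `<=` measurable.
Proof.
apply: smallest_sub; first exact: sigma_algebra_measurable.
exact: natural_generators_measurable.
Qed.

Lemma natural_filtrationP : filtration natural_filtration.
Proof.
split=> [t t0|t t0|s t s0' st].
- exact: smallest_sigma_algebra.
- exact: natural_filtration_measurable.
- apply: sub_smallest2r; first exact: smallest_sigma_algebra.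
  move=> _ [l ls ->]; exists l => //.
  by apply: sub_all ls => r /andP[-> /le_trans->].
Qed.

Lemma natural_filtration_preimage t (A : set T) : 0 <= t ->
  natural_filtration t ((phi \o Z t) @^-1` A).
Proof.
move=> t0; apply: sub_gen_smallest.
exists [:: (t, [set s | phi s \in A]%SET)]; first by rewrite /= t0 lexx.
rewrite cylinder1; apply/seteqP; split=> w /=; rewrite inE => H; first exact/mem_set.
exact: set_mem.
Qed.

Lemma lumped_adapted : adapted natural_filtration (fun t w => phi (Z t w)).
Proof. by move=> t v t0; exact: natural_filtration_preimage. Qed.

Lemma pr_markov_cylinder (l : seq (R * {set S})) s t a b :
  all (fun r => 0 <= r <= s) (unzip1 l) -> 0 <= s -> s <= t ->
  pr P (cylinder Z l `&` ((phi \o Z s) @^-1` [set a] `&` (phi \o Z t) @^-1` [set b]))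
    = transition q' (t - s) a b
      * pr P (cylinder Z l `&` (phi \o Z s) @^-1` [set a]).
Proof.
move=> ls s_ge0 st; pose l' := sort (relpre fst <=%R) l.
have -> : cylinder Z l = cylinder Z l'.
  by apply/seteqP; split=> w; rewrite /cylinder /= all_sort.
have l's : all (fun r => 0 <= r <= s) (unzip1 l').
  by rewrite /unzip1 all_map all_sort -all_map.
have cyl u c : (phi \o Z u) @^-1` [set c] = cylinder Z [:: pull (u, [set c]%SET)].
  rewrite cylinder1; apply/seteqP; split=> w /=; rewrite !inE; first by move->.
  by move/eqP.
have l'P (k : seq (R * {set S})) : path <=%R s (unzip1 k) ->
    path <=%R 0 (unzip1 (l' ++ k)).
  rewrite !(path_sortedE le_trans) /unzip1 map_cat all_cat => /andP[ks kP].
  apply/andP; split.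
    apply/andP; split; first by apply: sub_all l's => r /andP[].
    by apply: sub_all ks => r; exact: le_trans.
  rewrite (sorted_pairwise le_trans) pairwise_cat -!(sorted_pairwise le_trans) kP.
  rewrite sorted_map sort_sorted ?andbT; last by move=> u v; exact: le_total.
  apply/allrelP => u v /(allP l's)/andP[_ us] /(allP ks); exact: le_trans.
rewrite !cyl -!cylinder_cat !(pr_cylinder Zchain) ?box_prob_markov//.
- by apply: l'P; rewrite /= lexx.
- by apply: l'P; rewrite /= lexx st.
Qed.

(** With an absolute value, both sides are measures in [B] and the pi-lambda
    theorem extends the identity from cylinders. On a cylinder the absolute
    value is harmless: the transition probability is a ratio of probabilities
    unless both sides vanish. *)
Lemma pr_markov B s t a b : natural_filtration s B -> 0 <= s -> s <= t ->
  pr P (B `&` ((phi \o Z s) @^-1` [set a] `&` (phi \o Z t) @^-1` [set b]))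
    = `|transition q' (t - s) a b| * pr P (B `&` (phi \o Z s) @^-1` [set a]).
Proof.
move=> FB s_ge0 st; have t0 := le_trans s_ge0 st.
have mphi u c : 0 <= u -> measurable ((phi \o Z u) @^-1` [set c]).
  by case: lumped_is_ctmc => + _ _; apply.
have mE1 := mphi s a s_ge0.
have mE2 : measurable ((phi \o Z s) @^-1` [set a] `&` (phi \o Z t) @^-1` [set b]).
  by apply: measurableI => //; exact: mphi.
pose p : {nonneg R} := NngNum (normr_ge0 (transition q' (t - s) a b)).
pose m1 : {measure set Omega -> \bar R} := mrestr P mE2.
pose m2 : {measure set Omega -> \bar R} := mscale p (mrestr P mE1).
have mB := natural_filtration_measurable FB.
suff : m1 B = m2 B.
  rewrite /m1 /m2 /= /mscale /= /mrestr /= !prE; [|exact: measurableI..].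
  by rewrite -EFinM => -[].
apply: (g_sigma_algebra_measure_unique (natural_generators s)
  (@natural_generators_measurable s) (fun=> setT)) FB => //.
- move=> _; exists [::] => //; apply/seteqP; split=> //.
- by apply/seteqP; split=> // w _; exists 0%N.
- move=> _ _ [l1 l1s ->] [l2 l2s ->]; exists (l1 ++ l2).
    by rewrite /unzip1 map_cat all_cat l1s.
  by rewrite cylinder_cat.
- move=> _ [l ls ->].
  have mC := natural_generators_measurable (ex_intro2 _ _ l ls erefl).
  rewrite /m1 /m2 /= /mscale /= /mrestr /= !prE; [|exact: measurableI..].
  rewrite -EFinM pr_markov_cylinder//=; congr _%:E.
  have := pr_markov_cylinder a b ls s_ge0 st.
  set x := pr P (_ `&` (phi \o Z s) @^-1` [set a]).
  have [x0|x0] := eqVneq x 0; first by rewrite x0 !mulr0.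
  have xp : 0 < x by rewrite lt_neqAle eq_sym x0 pr_ge0.
  by move=> e; rewrite ger0_norm// -(pmulr_lge0 _ xp) -e pr_ge0.
- move=> _; rewrite /m1 /= /mrestr setTI (le_lt_trans (probability_le1 P mE2))//.
  exact: ltry.
Qed.

(** The version of the conditional law is the transition probability evaluated
    at the current position: it is a function of this position, hence measurable
    for both sigma-algebras. *)
Lemma lumped_markov : markov_wrt P natural_filtration (fun t w => phi (Z t w)).
Proof.
move=> s t b s_ge0 st; have t0 := le_trans s_ge0 st.
have mphi u c : 0 <= u -> measurable ((phi \o Z u) @^-1` [set c]).
  by case: lumped_is_ctmc => + _ _; apply.
pose p a : R := `|transition q' (t - s) a b|.
exists (fun w => p (phi (Z s w))).
have int_p B : natural_filtration s B ->
    (\int[P]_(w in B) (p (phi (Z s w)))%:E = P ((phi \o Z t) @^-1` [set b] `&` B))%E.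
  move=> FB; have mB := natural_filtration_measurable FB.
  rewrite (integral_finite_valued P (W := phi \o Z s)
    (fun a => mphi s a s_ge0))//; last first.
    by move=> a; exact: normr_ge0.
  rewrite prE; last by apply: measurableI => //; exact: mphi.
  rewrite (pr_total P (W := phi \o Z s) (fun a => mphi s a s_ge0)); last first.
    by apply: measurableI => //; exact: mphi.
  congr _%:E; apply: eq_bigr => a _; rewrite -pr_markov//; congr (pr P _).
  by rewrite [(phi \o Z t) @^-1` _ `&` B]setIC -setIA [X in B `&` X]setIC.
have mpB (C : set R) : (fun w => p (phi (Z s w))) @^-1` C
   = (phi \o Z s) @^-1` [set a | C (p a)] by [].
have integrable_p : P.-integrable [set: Omega] (EFin \o (fun w => p (phi (Z s w)))).
  apply: measurable_bounded_integrable => //.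
  - exact: le_lt_trans (probability_le1 P measurableT) (ltry _).
  - move=> _ C mC; rewrite setTI mpB; apply: natural_filtration_measurable.
    exact: natural_filtration_preimage s_ge0.
  - exists (\sum_a p a); split; first by rewrite num_real.
    move=> x px w _ /=; rewrite normr_id; apply: le_trans (ltW px).
    by rewrite (bigD1 (phi (Z s w)))//= lerDl sumr_ge0// => a _; exact: normr_ge0.
split; split => //.
- by move=> C mC; rewrite mpB; exact: natural_filtration_preimage.
- by move=> C mC; exists [set a | C (p a)] => //; rewrite setTI mpB.
- move=> _ [A _ <-]; rewrite setTI int_p//.
  exact: natural_filtration_preimage s_ge0.
Qed.

End LumpedChain.

(** * Survival along a coupling *)

Section MarkovStep.
Context {R : realType} {S : finType} {d : measure_display}.
Context {Omega : measurableType d} {P : probability Omega R}.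
Context {q : S -> S -> R} {s0 : S} {Z : R -> Omega -> S}.
Context {F : R -> set (set Omega)}.
Hypothesis Zchain : is_ctmc P q s0 Z.

Lemma pr_initial s : pr P (Z 0 @^-1` [set s]) = (s == s0)%:R.
Proof.
rewrite -cylinder_single (pr_cylinder Zchain) /= ?lexx//.
by rewrite big_set1 mulr1 subr0 transition0 eq_sym.
Qed.

Lemma pr_two_times s t a b : 0 <= s -> s <= t ->
  pr P (Z s @^-1` [set a] `&` Z t @^-1` [set b])
    = transition q (t - s) a b * pr P (Z s @^-1` [set a]).
Proof.
move=> s_ge0 st; rewrite -!cylinder_single -cylinder_cat.
rewrite !(pr_cylinder Zchain) /= ?s_ge0 ?st// !big_set1; ring.
Qed.

Hypotheses (Ffilt : filtration F) (Zadapted : adapted F Z).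
Hypothesis Zmarkov : markov_wrt P F Z.

(** A common version of the two conditional laws is a function of [Z s], hence
    constant on the event [Z s = a]; integrating it over this whole event
    identifies the constant with the transition probability. *)
Lemma coadapted_markov s t a b B : 0 <= s -> s <= t -> F s B ->
  B `<=` Z s @^-1` [set a] ->
  pr P (B `&` Z t @^-1` [set b]) = transition q (t - s) a b * pr P B.
Proof.
move=> s_ge0 st FB Ba; have t0 := le_trans s_ge0 st.
have mF C : F s C -> measurable C by case: Ffilt => _ + _; apply.
have mB := mF B FB.
have mt : measurable (Z t @^-1` [set b]) by exact: (ctmc_measurable Zchain).
have ms : measurable (Z s @^-1` [set a]) by exact: (ctmc_measurable Zchain).
have [pa0|pa0] := eqVneq (pr P (Z s @^-1` [set a])) 0.
  have p0 C : measurable C -> C `<=` Z s @^-1` [set a] -> pr P C = 0.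
    by move=> mC Ca; apply/eqP; rewrite eq_le pr_ge0 andbT -pa0 pr_le.
  rewrite !p0 ?mulr0//; first exact: measurableI.
  by move=> w [/Ba].
have [w0 w0a] : exists w, Z s w = a.
  apply: contrapT => /forallNP no; move/eqP: pa0; apply.
  rewrite (_ : _ @^-1` _ = set0) ?/pr ?measure0//.
  by apply/seteqP; split=> w // /no.
have [g [[_ _ gint] [gm _ _]]] := Zmarkov b s_ge0 st.
have ga w : Z s w = a -> g w = g w0.
  move=> wa; have [A _ eA] := gm [set g w0] (measurable_set1 _).
  have : (setT `&` Z s @^-1` A) w0 by rewrite eA.
  move=> [_ /=]; rewrite w0a -wa => Aw.
  have : (setT `&` Z s @^-1` A) w by [].
  by rewrite eA.
have gE C : F s C -> C `<=` Z s @^-1` [set a] ->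
    pr P (C `&` Z t @^-1` [set b]) = g w0 * pr P C.
  move=> FC Ca; have mC := mF C FC.
  apply: EFin_inj; rewrite EFinM -!prE//; last exact: measurableI.
  rewrite setIC -gint// (eq_integral (cst (g w0)%:E)); first exact: integral_cst.
  by move=> w /set_mem/Ca/ga ->.
have := gE _ (Zadapted a s_ge0) (fun w H => H).
by rewrite pr_two_times// => /(mulIf pa0) ->; exact: gE.
Qed.

End MarkovStep.

Section Telescoping.
Context {R : realType}.

(** Cut [0, t] into [K] steps: the total error is at most [C t^2 / K]. *)
Lemma telescope_quadratic_error (e : R -> R -> R) (C : R) :
  (forall s r h, 0 <= s -> 0 <= r -> 0 <= h <= 1 ->
     e s (r + h) <= e (s + h) r + C * h ^+ 2) ->
  forall t, 0 <= t -> e 0 t <= e t 0.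
Proof.
move=> step t t0.
apply/ler_addgt0Pr => eps eps0.
(* large enough for both h <= 1 and C t^2 / K <= eps *)
pose K := (Num.truncn (t + `|C| * t ^+ 2 / eps)).+1.
have KP : t + `|C| * t ^+ 2 / eps < K%:R by rewrite truncnS_gt.
have q0 : 0 <= `|C| * t ^+ 2 / eps by rewrite divr_ge0 ?mulr_ge0 ?exprn_ge0// ltW.
have K0 : 0 < K%:R :> R by rewrite ltr0n.
pose h := t / K%:R.
have h0 : 0 <= h by rewrite divr_ge0.
have h1 : h <= 1 by rewrite ler_pdivrMr// mul1r; lra.
have H k j : e (j%:R * h) (k%:R * h) <= e ((j + k)%:R * h) 0 + k%:R * (C * h ^+ 2).
  elim: k j => [|k IH] j; first by rewrite addn0 !mul0r addr0.
  have jh : 0 <= j%:R * h by rewrite mulr_ge0.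
  have kh : 0 <= k%:R * h by rewrite mulr_ge0.
  have := step _ _ h jh kh; rewrite h0 h1 => /(_ isT).
  have -> : k%:R * h + h = k.+1%:R * h by rewrite -natr1; ring.
  have -> : j%:R * h + h = j.+1%:R * h by rewrite -natr1; ring.
  have -> : k.+1%:R * (C * h ^+ 2) = k%:R * (C * h ^+ 2) + C * h ^+ 2.
    by rewrite -natr1; ring.
  by move=> /le_trans; apply; rewrite addrA lerD2r -addSnnS IH.
have := H K 0%N; rewrite mul0r add0n.
have -> : K%:R * h = t by rewrite /h mulrC divfK// gt_eqF.
move=> /le_trans; apply; rewrite lerD2l.
have -> : K%:R * (C * h ^+ 2) = C * t ^+ 2 / K%:R.
  by rewrite /h; field; rewrite gt_eqF.
rewrite ler_pdivrMr// (@le_trans _ _ (`|C| * t ^+ 2))//.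
  by rewrite ler_wpM2r ?exprn_ge0// ler_norm.
rewrite [leRHS]mulrC -ler_pdivrMr//; lra.
Qed.

End Telescoping.

Section MeanSurvival.
Context {R : realType} {n : nat} {d : measure_display}.
Context {Omega : measurableType d} {P : probability Omega R}.
Context {x0 y0 : hypercube n} {X Y : R -> Omega -> hypercube n}.
Hypothesis XY : is_coupling P x0 y0 X Y.
Implicit Types (x y z : hypercube n) (s t r h : R).

Let at_state t x y : set Omega := X t @^-1` [set x] `&` Y t @^-1` [set y].

Definition mean_surv s r : R :=
  \sum_x \sum_y pr P (at_state s x y) * surv #|unmatched x y| r.

Let mX t x : 0 <= t -> measurable (X t @^-1` [set x]).
Proof. by case: XY => cX _; exact: (ctmc_measurable cX). Qed.

Let mY t y : 0 <= t -> measurable (Y t @^-1` [set y]).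
Proof. by case: XY => _ cY; exact: (ctmc_measurable cY). Qed.

Let m_at t x y : 0 <= t -> measurable (at_state t x y).
Proof. by move=> t0; apply: measurableI; [exact: mX|exact: mY]. Qed.

Lemma pr_total2 t E : 0 <= t -> measurable E ->
  pr P E = \sum_x \sum_y pr P (E `&` at_state t x y).
Proof.
move=> t0 mE; rewrite (pr_total P (fun x => mX x t0) mE).
apply: eq_bigr => x _.
rewrite (pr_total P (fun y => mY y t0)); last by apply: measurableI => //; exact: mX.
by apply: eq_bigr => y _; rewrite setIA.
Qed.

Lemma sum_at_state t : 0 <= t -> \sum_x \sum_y pr P (at_state t x y) = 1.
Proof.
move=> t0; transitivity (pr P setT); last by rewrite /pr probability_setT.
rewrite (pr_total2 t0 measurableT).
by apply: eq_bigr => x _; apply: eq_bigr => y _; rewrite setTI.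
Qed.

Let mean_cst (c : R) t : 0 <= t -> c = \sum_x \sum_y pr P (at_state t x y) * c.
Proof.
move=> t0; rewrite -[LHS]mul1r -(sum_at_state t0) mulr_suml.
by apply: eq_bigr => x _; rewrite mulr_suml.
Qed.

(** All the mass is at the starting points. *)
Lemma mean_surv_start r : mean_surv 0 r = surv #|unmatched x0 y0| r.
Proof.
have other x y : (x, y) != (x0, y0) -> pr P (at_state 0 x y) = 0.
  case: XY => cX cY ne; apply/eqP; rewrite eq_le pr_ge0 andbT.
  have [xx|xx] := eqVneq x x0.
    have yy : y != y0 by apply: contra ne => /eqP ->; rewrite xx.
    have /= := pr_initial cY y; rewrite (negPf yy) => py.
    apply: le_trans (_ : _ <= pr P (Y 0 @^-1` [set y])) _; last by rewrite py.
    by apply: pr_le; [exact: m_at|exact: mY|exact: subIsetr].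
  have /= := pr_initial cX x; rewrite (negPf xx) => px.
  apply: le_trans (_ : _ <= pr P (X 0 @^-1` [set x])) _; last by rewrite px.
  by apply: pr_le; [exact: m_at|exact: mX|exact: subIsetl].
have sum0 (f : hypercube n -> hypercube n -> R) :
    \sum_x \sum_y pr P (at_state 0 x y) * f x y = pr P (at_state 0 x0 y0) * f x0 y0.
  rewrite (bigD1 x0)//= (bigD1 y0)//= big1 ?addr0; last first.
    by move=> y yy; rewrite other ?mul0r// xpair_eqE eqxx (negPf yy).
  rewrite big1 ?addr0// => x xx; rewrite big1// => y _.
  by rewrite other ?mul0r// xpair_eqE (negPf xx).
have p1 : pr P (at_state 0 x0 y0) = 1.
  rewrite -[LHS]mulr1 -(sum0 (fun _ _ => 1)) -[RHS](sum_at_state (lexx 0)).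
  by apply: eq_bigr => x _; apply: eq_bigr => y _; rewrite mulr1.
by rewrite /mean_surv sum0 p1 mul1r.
Qed.

Definition apart t : set Omega := [set w | X t w <> Y t w].

Lemma measurable_apart t : 0 <= t -> measurable (apart t).
Proof.
move=> t0; rewrite (_ : apart t =
  \bigcup_(p in [set p : hypercube n * hypercube n | p.1 <> p.2]) at_state t p.1 p.2).
  by apply: fin_bigcup_measurable => [|p _]; [exact: finite_finset|exact: m_at].
apply/seteqP; split=> w; first by move=> ne; exists (X t w, Y t w).
by move=> [p /= ne [/= Xp Yp]]; rewrite /apart /= Xp Yp.
Qed.

(** With no time left, [surv] is the indicator of being apart. *)
Lemma mean_surv_end t : 0 <= t -> mean_surv t 0 = pr P (apart t).
Proof.
move=> t0; rewrite (pr_total2 t0 (measurable_apart t0)).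
apply: eq_bigr => x _; apply: eq_bigr => y _.
have [<-|xy] := eqVneq x y.
  rewrite unmatched_refl cards0 surv0 mulr0 (_ : _ `&` _ = set0).
    by rewrite /pr measure0.
  by apply/seteqP; split=> w // [ne [/= Xx Yx]]; apply: ne; rewrite Xx Yx.
rewrite surv_at0 ?lt0n ?unmatched_eq0// mulr1; congr (pr P _).
apply/esym/setIidr => w [/= Xx Yy]; rewrite /apart /= Xx Yy.
exact/eqP.
Qed.

(** Conditionally on the positions at time [s], the positions at time [s + h] are
    coupled with the one-step laws of the walk as marginals, whatever the past,
    so that [one_step_lower] applies on each event of given positions. *)
Lemma coadapted_step s r h : coadapted P X Y ->
  0 <= s -> 0 <= r -> 0 <= h <= 1 ->
  mean_surv s (r + h) <= mean_surv (s + h) r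
    + (2 * second_order (@walk_rate R n) + 8 * n%:R ^+ 2) * h ^+ 2.
Proof.
move=> [F [Ff aX aY mkX mkY]] s_ge0 r0 h01; have /andP[h0 _] := h01.
set C := (_ + _) * _; case: (XY) => cX cY.
have t0 : 0 <= s + h by rewrite addr_ge0.
have st : s <= s + h by rewrite lerDl.
have hE : s + h - s = h by rewrite addrAC subrr add0r.
pose pi x y z z' := pr P (at_state s x y `&` at_state (s + h) z z').
have Fs x y : F s (at_state s x y).
  have [/(_ s s_ge0) sF _ _] := Ff; have [_ FC FU] := sF.
  rewrite /at_state -[X in F s X]setCK setCI -setTD.
  apply: (FC); rewrite -bigcup2E; apply: FU => -[|[|i]] /=.
  - by rewrite -setTD; apply: (FC); exact: aX.
  - by rewrite -setTD; apply: (FC); exact: aY.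
  - by case: sF.
have pix x y z : \sum_z' pi x y z z'
    = pr P (at_state s x y) * transition walk_rate h x z.
  rewrite mulrC -{1}hE -(coadapted_markov cX Ff aX mkX _ s_ge0 st (Fs x y));
    last exact: subIsetl.
  rewrite (pr_total P (fun y => mY y t0)); last first.
    by apply: measurableI; [exact: m_at|exact: mX].
  by apply: eq_bigr => z' _; rewrite /pi setIA.
have piy x y z' : \sum_z pi x y z z'
    = pr P (at_state s x y) * transition walk_rate h y z'.
  rewrite mulrC -{1}hE -(coadapted_markov cY Ff aY mkY _ s_ge0 st (Fs x y));
    last exact: subIsetr.
  rewrite (pr_total P (fun x => mX x t0)); last first.
    by apply: measurableI; [exact: m_at|exact: mY].
  by apply: eq_bigr => z _; rewrite /pi -setIA [X in _ `&` X]setIC.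
have -> : mean_surv (s + h) r
    = \sum_x \sum_y \sum_z \sum_z' pi x y z z' * surv #|unmatched z z'| r.
  transitivity (\sum_z \sum_z' \sum_x \sum_y pi x y z z' * surv #|unmatched z z'| r).
    apply: eq_bigr => z _; apply: eq_bigr => z' _.
    rewrite (pr_total2 s_ge0 (m_at z z' t0)) mulr_suml; apply: eq_bigr => x _.
    by rewrite mulr_suml; apply: eq_bigr => y _; rewrite /pi setIC.
  under eq_bigr do rewrite exchange_big; rewrite exchange_big /=.
  apply: eq_bigr => x _.
  under eq_bigr do rewrite exchange_big; rewrite exchange_big /=.
  by [].
have -> : mean_surv s (r + h)
    = (\sum_x \sum_y pr P (at_state s x y) * (surv #|unmatched x y| (r + h) - C)) + C.
  rewrite [X in _ = _ + X](mean_cst C s_ge0) -big_split /=.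
  apply: eq_bigr => x _; rewrite -big_split /=.
  by apply: eq_bigr => y _; rewrite -mulrDr subrK.
rewrite lerD2r; apply: ler_sum => x _; apply: ler_sum => y _.
apply: one_step_lower => //; first exact: pr_ge0.
by move=> z z'; exact: pr_ge0.
Qed.

Lemma hat_step s r h : is_hat_strategy P x0 y0 X Y ->
  0 <= s -> 0 <= r -> 0 <= h <= 1 ->
  mean_surv (s + h) r <= mean_surv s (r + h)
    + (second_order (@hat_rate R n) + 8 * n%:R ^+ 2) * h ^+ 2.
Proof.
move=> cZ s_ge0 r0 h01; have /andP[h0 _] := h01.
set C := (_ + _) * _.
have t0 : 0 <= s + h by rewrite addr_ge0.
have st : s <= s + h by rewrite lerDl.
have hE : s + h - s = h by rewrite addrAC subrr add0r.
pose Z t w := (X t w, Y t w).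
have atE t x y : at_state t x y = Z t @^-1` [set (x, y)].
  by apply/seteqP; split=> w;
    [move=> [/= Xx Yy]; rewrite /Z /= Xx Yy|move=> [/= <- <-]].
have -> : mean_surv (s + h) r = \sum_x \sum_y pr P (at_state s x y)
    * \sum_z transition hat_rate h (x, y) z * surv #|unmatched z.1 z.2| r.
  transitivity (\sum_z \sum_z' \sum_x \sum_y pr P (at_state s x y) *
      (transition hat_rate h (x, y) (z, z') * surv #|unmatched z z'| r)).
    apply: eq_bigr => z _; apply: eq_bigr => z' _.
    rewrite (pr_total2 s_ge0 (m_at z z' t0)) mulr_suml; apply: eq_bigr => x _.
    rewrite mulr_suml; apply: eq_bigr => y _.
    by rewrite setIC !atE (pr_two_times cZ)// hE; ring.
  under eq_bigr do rewrite exchange_big; rewrite exchange_big /=.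
  apply: eq_bigr => x _.
  under eq_bigr do rewrite exchange_big; rewrite exchange_big /=.
  apply: eq_bigr => y _; rewrite mulr_sumr pair_bigA /=.
  by apply: eq_bigr => -[z z'] _.
have -> : mean_surv s (r + h) + C
    = \sum_x \sum_y pr P (at_state s x y) * (surv #|unmatched x y| (r + h) + C).
  rewrite [X in _ + X = _](mean_cst C s_ge0) -big_split /=.
  apply: eq_bigr => x _; rewrite -big_split /=.
  by apply: eq_bigr => y _; rewrite -mulrDr.
apply: ler_sum => x _; apply: ler_sum => y _.
by rewrite ler_wpM2l ?pr_ge0// one_step_hat.
Qed.

Lemma coadapted_apart_ge t : 0 <= t -> coadapted P X Y ->
  surv #|unmatched x0 y0| t <= pr P (apart t).
Proof.
move=> t0 co; rewrite -mean_surv_end// -mean_surv_start.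
exact: telescope_quadratic_error (fun s r h => coadapted_step co) _ t0.
Qed.

Lemma hat_apart_le t : 0 <= t -> is_hat_strategy P x0 y0 X Y ->
  pr P (apart t) <= surv #|unmatched x0 y0| t.
Proof.
move=> t0 hat; rewrite -mean_surv_end// -mean_surv_start -lerN2.
apply: (telescope_quadratic_error (e := fun s r => - mean_surv s r)
  (C := second_order (@hat_rate R n) + 8 * n%:R ^+ 2)) => // s r h s0 r0 h01.
by have := hat_step hat s0 r0 h01; lra.
Qed.

(** Right-continuous paths in a discrete space stay apart for a while. *)
Lemma apart_right_open s w : 0 <= s -> apart s w ->
  exists2 a, s < a & forall u, s <= u -> u < a -> apart u w.
Proof.
move=> s0 XYs; case: XY => -[_ cX _] [_ cY _].
have [Xr _] := cX w s s0; have [Yr _] := cY w s s0.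
have [e /= e0 He] : \forall u \near s^'+, apart u w.
  by near=> u; rewrite /apart /= (near Xr u)// (near Yr u).
exists (s + e); first by rewrite ltrDl.
move=> u su ue; move: (su); rewrite le_eqVlt => /predU1P[<- //|su'].
by apply: He => //=; rewrite distrC ger0_norm ?subr_ge0// ltrBlDl.
Unshelve. all: by end_near. Qed.

(** The coupling time exceeds [t] if and only if the walks are apart at some
    later time, which can be taken rational by right-continuity. *)
Lemma coupling_time_gtE t : 0 <= t ->
  [set w | (t%:E < coupling_time X Y w)%E]
    = \bigcup_(a in [set a : rat | t < ratr a]) apart (ratr a).
Proof.
move=> t0; apply/seteqP; split=> w /=.
  apply: contraPP => no; apply/negP; rewrite -leNgt; apply: ereal_inf_lbound.
  exists t => //; split=> // s ts; apply: contrapT => XYs.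
  have [a sa Ha] := apart_right_open (le_trans t0 ts) XYs.
  have [c] := rat_in_itvoo sa; rewrite in_itv/= => /andP[sc ca].
  by apply: no; exists c; [exact: le_lt_trans sc|apply: Ha => //; exact: ltW].
move=> [c tc XYc]; apply: lt_le_trans (_ : t%:E < (ratr c)%:E)%E _.
  by rewrite lte_fin.
apply: le_ereal_inf_tmp => _ [s [s0 Hs] <-]; rewrite lee_fin leNgt; apply/negP => sc.
by apply: XYc; apply: Hs; exact: ltW.
Qed.

Lemma measurable_coupling_time_gt t : 0 <= t ->
  measurable [set w | (t%:E < coupling_time X Y w)%E].
Proof.
move=> t0; rewrite coupling_time_gtE//.
rewrite bigcup_mkcond; apply: bigcupT_measurable_rat => a.
case: ifP => // /set_mem ta; apply: measurable_apart; exact: le_trans (ltW ta).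
Qed.

Lemma apart_le_coupling_tail t : 0 <= t ->
  ((pr P (apart t))%:E <= coupling_tail P X Y t)%E.
Proof.
move=> t0; rewrite -prE; last exact: measurable_apart.
apply: le_measure; rewrite ?inE.
- exact: measurable_apart.
- exact: measurable_coupling_time_gt.
- rewrite coupling_time_gtE// => w XYt.
  have [a ta Ha] := apart_right_open t0 XYt.
  have [c] := rat_in_itvoo ta; rewrite in_itv/= => /andP[tc ca].
  by exists c => //; apply: Ha => //; exact: ltW.
Qed.

(** The strategy moves matched walks together. *)
Lemma hat_separation_null t u : is_hat_strategy P x0 y0 X Y ->
  0 <= t -> t <= u -> pr P (apart u `&` ~` apart t) = 0.
Proof.
move=> cZ t0 tu; have u0 := le_trans t0 tu.
have mE : measurable (apart u `&` ~` apart t).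
  by apply: measurableI; [|apply: measurableC]; exact: measurable_apart.
have pr0 A : A = set0 -> pr P A = 0 by move=> ->; rewrite /pr measure0.
rewrite (pr_total2 t0 mE) big1// => x _; rewrite big1// => y _.
have [<-{y}|xy] := eqVneq x y; last first.
  apply: pr0; apply/seteqP; split=> w //= [[_ XYt] [/= Xx Yy]].
  by move/eqP: xy; apply; rewrite -Xx -Yy; apply: contrapT.
rewrite (pr_total2 u0); last by apply: measurableI => //; exact: m_at.
rewrite big1// => z _; rewrite big1// => z' _.
have [<-{z'}|zz] := eqVneq z z'.
  by apply: pr0; apply/seteqP; split=> w //= [[[+ _] _] [/= Xz Yz]]; apply;
     rewrite Xz Yz.
have : pr P (at_state t x x `&` at_state u z z') = 0.
  have := pr_two_times cZ (x, x) (z, z') t0 tu.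
  rewrite hat_diag_absorbing// mul0r => <-; congr (pr P _).
  apply/seteqP; split=> w /=; last by move=> [[Xx Yx] [Xz Yz]].
  by move=> [[/= Xx Yx] [/= Xz Yz]]; rewrite Xx Yx Xz Yz.
move=> e; apply/eqP; rewrite eq_le pr_ge0 andbT -[leRHS]e; apply: pr_le.
- by apply: measurableI; [apply: measurableI => //|]; exact: m_at.
- by apply: measurableI; exact: m_at.
- by move=> w [[_ ?] ?]; split.
Qed.

Lemma hat_coupling_tail t : is_hat_strategy P x0 y0 X Y -> 0 <= t ->
  (coupling_tail P X Y t <= (pr P (apart t))%:E)%E.
Proof.
move=> cZ t0;
(* the rationals beyond t enumerated by nat, for countable subadditivity *)
pose N k := if @choice.unpickle rat k is Some a then
  if t < ratr a then apart (ratr a) `&` ~` apart t else set0 else set0.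
have mN k : measurable (N k).
  rewrite /N; case: choice.unpickle => // a; case: ifP => // ta.
  apply: measurableI; last exact/measurableC/measurable_apart.
  exact: measurable_apart (le_trans t0 (ltW ta)).
have mUN : measurable (\bigcup_k N k) by exact: bigcupT_measurable.
have N0 : P (\bigcup_k N k) = 0%E.
  apply: measure_negligible => //; apply: negligible_bigcup => k.
  apply/negligibleP => //; rewrite /N;
  case: choice.unpickle => [a|]; last exact: measure0.
  case: ifP => ta; last exact: measure0.
  have mA : measurable (apart (ratr a) `&` ~` apart t).
    by move: (mN (choice.pickle a)); rewrite /N choice.pickleK ta.
  by apply: etrans (prE P mA) _; rewrite hat_separation_null// ltW.
rewrite -prE; last exact: measurable_apart.
rewrite -(measureU0 (measurable_apart t0) mUN N0).
apply: le_measure; rewrite ?inE.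
- exact: measurable_coupling_time_gt.
- by apply: measurableU => //; exact: measurable_apart.
rewrite coupling_time_gtE// => w [a ta XYa].
have [XYt|XYt] := pselect (apart t w); [by left|right].
exists (choice.pickle a); first exact: Logic.I.
by rewrite /N choice.pickleK ifT//; split.
Qed.

End MeanSurvival.

(** * Optimality of the strategy *)

Lemma hat_is_coupling (R : realType) (n : nat) (x y : hypercube n)
    (d : measure_display) (Omega : measurableType d) (P : probability Omega R)
    (X Y : R -> Omega -> hypercube n) :
  is_hat_strategy P x y X Y -> is_coupling P x y X Y.
Proof.
move=> hat; split; [exact: lumped_is_ctmc hat (@gen_hat_fst R n)|].
exact: lumped_is_ctmc hat (@gen_hat_snd R n).
Qed.

Lemma hat_coadapted (R : realType) (n : nat) (x y : hypercube n)
    (d : measure_display) (Omega : measurableType d) (P : probability Omega R)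
    (X Y : R -> Omega -> hypercube n) :
  is_hat_strategy P x y X Y -> coadapted P X Y.
Proof.
move=> hat; exists (natural_filtration (Z := fun t w => (X t w, Y t w))); split.
- exact: natural_filtrationP hat.
- exact: (lumped_adapted (phi := fst)).
- exact: (lumped_adapted (phi := snd)).
- exact: lumped_markov hat (@gen_hat_fst R n).
- exact: lumped_markov hat (@gen_hat_snd R n).
Qed.

Theorem theorem3p1 (R : realType) (n : nat) (hn : (1 <= n)%N)
    (x y : hypercube n) (t : R) (ht : 0 <= t)
    (d : measure_display) (Omega : measurableType d) (P : probability Omega R)
    (Xhat Yhat : R -> Omega -> hypercube n)
    (hhat : is_hat_strategy P x y Xhat Yhat) :
  coupling_tail P Xhat Yhat t = ereal_inf (coadapted_tails x y t).
Proof.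
have coup := hat_is_coupling hhat; have coad := hat_coadapted hhat.
apply/eqP; rewrite eq_le; apply/andP; split; last first.
  by apply: ereal_inf_lbound; exists d, Omega, P, Xhat, Yhat.
apply: le_ereal_inf_tmp => _ [d' [W [P' [X [Y []]]]]] XY XYco ->.
apply: le_trans (hat_coupling_tail coup hhat ht) _.
apply: le_trans (_ : _ <= (surv #|unmatched x y| t)%:E)%E _.
  by rewrite lee_fin hat_apart_le.
apply: le_trans (apart_le_coupling_tail XY ht).
by rewrite lee_fin (coadapted_apart_ge XY).
Qed.
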